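(* Let $\{x_i(t)\}_{t=1}^\infty$, $i\in V$, be generated by distributed dual averaging with stochastic gradients (see context), with fixed doubly stochastic matrix $P$ and non-increasing positive step sizes $\{\alpha(t)\}_{t=0}^\infty$, where the vectors $\hat g_i(t)$ satisfy $\mathbb{E}[\hat g_i(t)\mid\mathcal{F}_{t-1}]\in\partial f_i(x_i(t))$ and $\mathbb{E}[\|\hat g_i(t)\|_*^2\mid\mathcal{F}_{t-1}]\le L^2$. Let $x^*\in\mathcal{X}$. (1) For each $i\in V$, $$\mathbb{E}\big[f(\hat x_i(T))\big]-f(x^* )\le\frac{1}{T\alpha(T)}\psi(x^* )+\frac{8L^2}{T}\sum_{t=1}^T\alpha(t-1)+\frac{3L^2}{T}\frac{\log(T\sqrt n)}{1-\sigma_2(P)}\sum_{t=1}^T\alpha(t).$$ (2) If in addition $\mathcal{X}$ has finite radius $R=\sup_{x\in\mathcal{X}}\|x-x^*\|$ and $\|\hat g_i(t)\|_*\le L$ for all $i,t$, then for each $i\in V$ and $\delta\in(0,1)$, with probability at least $1-\delta$, $$f(\hat x_i(T))-f(x^* )\le\frac{1}{T\alpha(T)}\psi(x^* )+\frac{8L^2}{T}\sum_{t=1}^T\alpha(t-1)+\frac{3L^2}{T}\frac{\log(T\sqrt n)}{1-\sigma_2(P)}\sum_{t=1}^T\alpha(t)+8LR\sqrt{\frac{\log\frac1\delta}{T}}.$$ (3) If, further to the assumptions of (2), the gradient estimates $\hat g_i(t)$, $i\in V$, are uncorrelated given $\mathcal{F}_{t-1}$, then for each $i\in V$ and $\delta\in(0,1)$,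 with probability at least $1-\delta$, $$f(\hat x_i(T))-f(x^* )\le\frac{1}{T\alpha(T)}\psi(x^* )+\frac{8L^2}{T}\sum_{t=1}^T\alpha(t-1)+\frac{3L^2}{T}\frac{\log(T\sqrt n)}{1-\sigma_2(P)}\sum_{t=1}^T\alpha(t)+\frac{3LR\log\frac1\delta}{T}+4LR\sqrt{\frac{\log\frac1\delta}{nT}}.$$
   Context: Problem: $G=(V,E)$ is an undirected graph with $V=\{1,\dots,n\}$, $n\ge2$; each $f_i:\mathbb{R}^d\to\mathbb{R}$ ($i\in V$) is convex; $\mathcal{X}\subseteq\mathbb{R}^d$ is closed and convex with $0\in\mathcal{X}$; $f(x)=\frac1n\sum_{i=1}^n f_i(x)$ is to be minimized over $\mathcal{X}$. Norms and Lipschitz assumption: $\|\cdot\|$ is a norm on $\mathbb{R}^d$ with dual norm $\|v\|_*=\sup_{\|u\|=1}\langle v,u\rangle$. Each $f_i$ is $L$-Lipschitz on $\mathcal{X}$: $|f_i(x)-f_i(y)|\le L\|x-y\|$ for $x,y\in\mathcal{X}$, and all subgradients $g\in\partial f_i(x)$, $x\in\mathcal{X}$, satisfy $\|g\|_*\le L$. Proximal function: $\psi:\mathbb{R}^d\to\mathbb{R}$ is differentiable and 1-strongly convex w.r.t. $\|\cdot\|$ on $\mathcal{X}$, i.e. $\psi(y)\ge\psi(x)+\langle\nabla\psi(x),y-x\rangle+\frac12\|x-y\|^2$ for all $x,y\in\mathcal{X}$; moreover $\psi\ge0$ on $\mathcal{X}$ and $\psi(0)=0$. For $z\in\mathbb{R}^d$,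 $\alpha>0$ set $\Pi(z,\alpha)=\operatorname{argmin}_{x\in\mathcal{X}}\{\langle z,x\rangle+\frac1\alpha\psi(x)\}$. Communication matrix: $P\in\mathbb{R}^{n\times n}$ is doubly stochastic (nonnegative entries, row and column sums equal to 1), with $P_{ij}>0$ for $i\ne j$ only if $(i,j)\in E$; $\sigma_2(P)$ is its second largest singular value, understood to satisfy $\sigma_2(P)<1$. Distributed dual averaging with stochastic gradients: start with $z_i(1)=0$ and $x_i(1)=\Pi(0,\alpha(0))$ for all $i$. For $t\ge1$ each node $i$ receives a random vector $\hat g_i(t)$ and sets $z_i(t+1)=\sum_{j=1}^n P_{ij}z_j(t)+\hat g_i(t)$ and $x_i(t+1)=\Pi(z_i(t+1),\alpha(t))$. $\mathcal{F}_t$ is the $\sigma$-field of all information up to time $t$: $\hat g_i(1),\dots,\hat g_i(t)$ and $x_i(1),\dots,x_i(t+1)$ are $\mathcal{F}_t$-measurable for all $i$. The running local average is $\hat x_i(T)=\frac1T\sum_{t=1}^T x_i(t)$, $T\ge1$. ''Uncorrelated given $\mathcal{F}_{t-1}$'' means that, with $g_i(t)=\mathbb{E}[\hat g_i(t)\mid\mathcal{F}_{t-1}]$, $\mathbb{E}[\langle\hat g_i(t)-g_i(t),u\rangle\langle\hat g_j(t)-g_j(t),v\rangle\mid\mathcal{F}_{t-1}]=0$ for all $i\ne j$ and $u,v\in\mathbb{R}^d$. *)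

(* Defs.v *)
From HB Require Import structures.
From mathcomp Require Import all_boot all_order all_algebra.
From mathcomp Require Import all_classical all_reals all_analysis.
From mathcomp Require Import polyrcf.

Set Implicit Arguments.
Unset Strict Implicit.
Unset Printing Implicit Defensive.

Import Order.TTheory GRing.Theory Num.Theory.
Import numFieldNormedType.Exports.

Local Open Scope classical_set_scope.
Local Open Scope ring_scope.

Section euclidean.
Context {R : realType} {d : nat}.
Notation V := 'rV[R]_d.
Implicit Types (N f psi : V -> R) (X : set V) (u v x y z : V).

Definition dotp u v : R := \sum_(k < d) u 0 k * v 0 k.

(* An arbitrary norm on R^d, unrelated to the canonical (sup) norm of 'rV_d;
   the latter only provides the topology. *)
Definition is_norm N : Prop :=
  [/\ forall u v, N (u + v) <= N u + N v,
      forall (a : R) u, N (a *: u) = `|a| * N u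
    & forall u, N u = 0 -> u = 0].

Definition dual_norm N v : R := sup [set dotp v u | u in [set u | N u = 1]].

Definition subdifferential f x : set V :=
  [set g | forall y, f x + dotp g (y - x) <= f y].

Definition gradient f x : V := \row_k 'D_(delta_mx 0 k) f x.

Definition strongly_convex1 N X psi : Prop :=
  forall x y, X x -> X y ->
    psi x + dotp (gradient psi x) (y - x) + 2^-1 * N (x - y) ^+ 2 <= psi y.

(* The argmin as a set; for the functions used here it is a singleton. *)
Definition argmin X f : set V :=
  [set x | X x /\ forall y, X y -> f x <= f y].

Definition prox X psi z (a : R) : set V :=
  argmin X (fun x => dotp z x + a^-1 * psi x).

End euclidean.

Section matrices.
Context {R : realType} {n : nat}.
Implicit Type A : 'M[R]_n.

Definition doubly_stochastic A : Prop :=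
  [/\ forall i j, 0 <= A i j,
      forall i, \sum_j A i j = 1
    & forall j, \sum_i A i j = 1].

(* Square roots of the eigenvalues of A^T A, with (algebraic) multiplicity, in
   decreasing order: [rootsR] lists the distinct real roots increasingly, and
   all the roots are real since A^T A is symmetric. *)
Definition singular_values A : seq R :=
  let p := char_poly (A^T *m A) in
  rev (flatten [seq nseq (mup a p) (Num.sqrt a) | a <- rootsR p]).

Definition sigma2 A : R := (singular_values A)`_1.

End matrices.

Section probability.
Context {R : realType} {dO : measure_display} {Omega : measurableType dO}.
Implicit Types (mu : probability Omega R) (G : set (set Omega)).
Implicit Types (F : nat -> set (set Omega)).

Definition filtration F : Prop :=
  [/\ forall t, sigma_algebra setT (F t),
      forall t, F t `<=` measurable
    & forall s t, (s <= t)%N -> F s `<=` F t].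

Definition measurable_wrt G (Y : Omega -> R) : Prop :=
  forall B : set R, measurable B -> G (Y @^-1` B).

Definition vec_measurable_wrt G d (Y : Omega -> 'rV[R]_d) : Prop :=
  forall k, measurable_wrt G (fun w => Y w 0 k).

(* Y is a version of E[X | G]. *)
Definition is_cond_exp mu G (X Y : Omega -> R) : Prop :=
  [/\ mu.-integrable setT (EFin \o X),
      mu.-integrable setT (EFin \o Y),
      measurable_wrt G Y
    & forall A, G A ->
        (\int[mu]_(w in A) (Y w)%:E = \int[mu]_(w in A) (X w)%:E)%E].

Definition is_vec_cond_exp mu G d (X Y : Omega -> 'rV[R]_d) : Prop :=
  forall k, is_cond_exp mu G (fun w => X w 0 k) (fun w => Y w 0 k).

(* E[X | G] <= c almost surely. *)
Definition cond_exp_le mu G (X : Omega -> R) (c : R) : Prop :=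
  exists2 Y, is_cond_exp mu G X Y & {ae mu, forall w, Y w <= c}.

End probability.

Section dual_averaging.
Context {R : realType} {n d : nat}.

Definition objective (f : 'I_n -> 'rV[R]_d -> R) (x : 'rV[R]_d) : R :=
  n%:R^-1 * \sum_i f i x.

Definition radius_about (N : 'rV[R]_d -> R) (X : set 'rV[R]_d) (xs : 'rV[R]_d) : R :=
  sup [set N (x - xs) | x in X].

Context {dO : measure_display} {Omega : measurableType dO}.
Implicit Types (x z g ghat : 'I_n -> nat -> Omega -> 'rV[R]_d).

(* Times start at 1: the values of z, x and ghat at time 0 play no role. *)
Definition dual_averaging (X : set 'rV[R]_d) psi (P : 'M[R]_n)
    (alpha : nat -> R) ghat z x : Prop :=
  [/\ forall i w, z i 1%N w = 0,
      forall i w, prox X psi 0 (alpha 0%N) (x i 1%N w),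
      forall i t w, (1 <= t)%N ->
        z i t.+1 w = \sum_j P i j *: z j t w + ghat i t w
    & forall i t w, (1 <= t)%N ->
        prox X psi (z i t.+1 w) (alpha t) (x i t.+1 w)].

Definition adapted (F : nat -> set (set Omega)) ghat x : Prop :=
  (forall i s t, (1 <= s <= t)%N -> vec_measurable_wrt (F t) (ghat i s)) /\
  (forall i s t, (1 <= s <= t.+1)%N -> vec_measurable_wrt (F t) (x i s)).

Definition running_average x i (T : nat) (w : Omega) : 'rV[R]_d :=
  T%:R^-1 *: \sum_(1 <= t < T.+1) x i t w.

Definition uncorrelated (mu : probability Omega R) (F : nat -> set (set Omega))
    ghat g : Prop :=
  forall t i j u v, (1 <= t)%N -> i != j ->
    is_cond_exp mu (F t.-1)
      (fun w => dotp (ghat i t w - g i t w) u * dotp (ghat j t w - g j t w) v)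
      (cst 0).

End dual_averaging.

(* The terms shared by the three bounds, where [psixs] is the value of psi at
   the comparison point and [s] is sigma_2 of the communication matrix. *)
Definition base_bound {R : realType} (n : nat) (L s : R) (alpha : nat -> R)
    (psixs : R) (T : nat) : R :=
  (T%:R * alpha T)^-1 * psixs
  + 8 * L ^+ 2 / T%:R * \sum_(1 <= t < T.+1) alpha t.-1
  + 3 * L ^+ 2 / T%:R * (ln (T%:R * Num.sqrt n%:R) / (1 - s))
    * \sum_(1 <= t < T.+1) alpha t.

(* Main.v *)
(* Because the network terms carry the coefficient 3 log (T sqrt n) / (1 - sigma_2),
   comparing every node with the prox of the averaged dual variable (which costs
   twice as much) is not enough.  Instead, the regret
   sum_t mean_j <ghat_j(t), x_j(t) - x*> is compared with a sequence C which mixes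
   after the gradient step, C(t+1) = W(t) (C(t) + ghat(t)) with W(t) doubly
   stochastic: by Jensen's inequality the mean over the nodes of the Fenchel
   potential of C pays nothing for mixing.  The actual iterates mix before the
   gradient step, z(t+1) = P z(t) + ghat(t), so that ghat(s) carries one factor P
   less in z(t) than in C(t) if W = P throughout.  Taking W = I once every k + 1
   steps, where k is the mixing time log (T sqrt n) / (1 - sigma_2), cancels that
   factor for every gradient older than the last skip; the remaining ones
   contribute 2 ((t - 1) mod (k + 1)), which is k on average, half of the naive
   2 k.  Together with 2 k for replacing x_i(t) by x_j(t), this gives 3 k.

   In expectation the products of gradient norms are split by AM-GM and the noise
   <g_j - ghat_j, x_j - x*> has mean zero; with high probability, the noise is a
   bounded martingale difference controlled by Bernstein's inequality. *)

Require Import Defs.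
From HB Require Import structures.
From mathcomp Require Import all_boot all_order all_algebra.
From mathcomp Require Import all_classical all_reals all_analysis.
From mathcomp Require Import polyrcf complex measurable_realfun.
From mathcomp Require Import zify ring lra.

Set Implicit Arguments.
Unset Strict Implicit.
Unset Printing Implicit Defensive.

Import Order.TTheory GRing.Theory Num.Theory.
Import numFieldNormedType.Exports.

Local Open Scope classical_set_scope.
Local Open Scope ring_scope.

(** * Singular values *)

(** Constants. Per step the error is 1/2 from the gradient step, 2 k + 2 from consensus and 2 p + 2
    from the gap to C, where p runs through the sawtooth and each final 2 is a tail of at most T
    terms 2 / T. As 2 p averages k, and k exceeds log (T sqrt n) / (1 - sigma_2) by at most 1, the
    total is 15/2 plus three times that quotient, and 8 leaves room. AM-GM makes the network error
    affine in the squared gradient norms with nonnegative coefficients, so one quantity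
    [network_bound] is evaluated at L^2 both under the expectation and almost surely. For the noise,
    exp x <= 1 + x + x^2 on |x| <= 2/3 gives the deviation 2 sqrt(T v log(1/delta)) + 3/2 c
    log(1/delta). With c = 2 L R this is where 3 L R and 4 L R come from; v = c^2 yields (2) and v =
    c^2 / n yields (3). *)

Section singular_values.
Local Open Scope sesquilinear_scope.

(** A real symmetric matrix is Hermitian over [R[i]], where the spectral theorem for normal matrices
    applies; its eigenvalues are real, so they are recorded as [d] in [R] although [U] is
    complex. *)
Lemma symmetric_spectral (R : rcfType) n (S : 'M[R]_n) : S^T = S ->
  exists (U : 'M[R[i]]_n) (d : 'I_n -> R), U \is unitarymx /\
    map_mx (real_complex R) S =
      U ^t* *m diag_mx (\row_i real_complex R (d i)) *m U.
Proof.
move=> Ssym; set A := map_mx _ S.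
have Ah : A \is hermsymmx.
  apply/is_hermitianmxP; rewrite expr0 scale1r /A -[in LHS]Ssym.
  by apply/matrixP => i j; rewrite !mxE; exact/esym/conjc_real.
have /orthomx_spectralP AE := hermitian_normalmx Ah.
have /mxOverP dr := hermitian_spectral_diag_real Ah.
clearbody A; exists (spectralmx A), (fun i => complex.Re (spectral_diag A 0 i)).
split; first exact: spectral_unitarymx.
rewrite -(invmx_unitary (spectral_unitarymx A)).
suff -> : \row_i real_complex R (complex.Re (spectral_diag A 0 i)) = spectral_diag A.
  exact: AE.
by apply/rowP => i; rewrite mxE RRe_real.
Qed.

Lemma char_poly_conj (F : fieldType) n (U D : 'M[F]_n) : U \in unitmx ->
  char_poly (invmx U *m D *m U) = char_poly D.
Proof.
move=> Uu; rewrite /char_poly.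
have -> : char_poly_mx (invmx U *m D *m U)
        = map_mx polyC (invmx U) *m char_poly_mx D *m map_mx polyC U.
  rewrite /char_poly_mx mulmxBr mulmxBl -!map_mxM; congr (_ - _).
  rewrite -mulmxA mul_scalar_mx -scalemxAr -map_mxM mulVmx// map_mx1.
  by rewrite scalemx1.
by rewrite !det_mulmx mulrAC -det_mulmx -map_mxM mulVmx// map_mx1 det1 mul1r.
Qed.

Lemma char_poly_spectral (R : rcfType) n (S : 'M[R]_n) (U : 'M[R[i]]_n)
    (d : 'I_n -> R) : U \is unitarymx ->
  map_mx (real_complex R) S =
      U ^t* *m diag_mx (\row_i real_complex R (d i)) *m U ->
  char_poly S = \prod_i ('X - (d i)%:P).
Proof.
move=> Uu SE; apply: (@map_poly_inj _ _ (real_complex R)).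
rewrite map_char_poly SE -invmx_unitary// char_poly_conj ?unitarymx_unit//.
rewrite char_poly_trig ?diag_mx_is_trig// rmorph_prod; apply: eq_bigr => i _.
by rewrite rmorphB /= map_polyX map_polyC !mxE eqxx mulr1n.
Qed.

(** Ties the computed list of [singular_values] to a diagonalization: both lists contain each [x] as
    often as its multiplicity as a root of [p]. *)
Lemma flatten_mup_prod (R : rcfType) (I : finType) (d : I -> R)
    (p := \prod_i ('X - (d i)%:P)) :
  perm_eq (flatten [seq nseq (mup a p) a | a <- rootsR p])
    [seq d i | i <- enum I].
Proof.
have pE : p = \prod_(y <- [seq d i | i <- enum I]) ('X - y%:P).
  by rewrite big_map big_enum.
have p0 : p != 0 by rewrite pE monic_neq0 ?monic_prod_XsubC.
have rE : rootsR p =i [seq d i | i <- enum I].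
  move=> x; have := roots_onP (roots_on_rootsR p0) (x := x).
  by rewrite in_itv => /(_ isT) /= <-; rewrite pE root_prod_XsubC.
have ur : uniq (rootsR p) by exact/(sorted_uniq lt_trans ltxx)/sorted_roots.
apply/allP => x _ /=; apply/eqP.
have cE : count_mem x (flatten [seq nseq (mup a p) a | a <- rootsR p])
  = (\sum_(a <- rootsR p) (a == x) * mup a p)%N.
  elim: (rootsR p) => [|a s IH] /=; first by rewrite big_nil.
  by rewrite count_cat IH big_cons count_nseq.
rewrite cE -[RHS]mu_prod_XsubC -pE.
have [xr|xr] := boolP (x \in rootsR p).
  rewrite (bigD1_seq x)//= eqxx mul1n big1 ?addn0// => a /negPf ->.
  by rewrite mul0n.
rewrite big_seq big1 ?mupNroot//.
  by rewrite pE root_prod_XsubC -rE.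
by move=> a ar; case: eqP => [ax|]; rewrite ?mul0n// -ax ar in xr.
Qed.

(** If two entries with distinct indices both exceeded the second entry of a decreasing list, two
    positions would carry larger values, but only the head can. *)
Lemma nth1_sorted_ge (R : realDomainType) (I : finType) (r : I -> R) (s : seq R) i j :
  sorted >=%R s -> perm_eq s [seq r k | k <- enum I] -> i != j ->
  Num.min (r i) (r j) <= s`_1.
Proof.
move=> s_sorted s_perm ij.
have lt1s : (1 < size s)%N.
  rewrite (perm_size s_perm) size_map -cardE (cardD1 i) (cardD1 j) !inE eq_sym.
  by rewrite ij.
case: s s_sorted s_perm lt1s => [//|x [//|y s]] /= /andP[_ ys] s_perm _.
rewrite leNgt; apply/negP => ylt.
have : (count (fun z => (y < z)%R) (x :: y :: s) <= 1)%N.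
  rewrite /= ltxx add0n addnC (_ : count _ s = 0%N) ?leq_b1//.
  apply/eqP; rewrite -leqn0 leqNgt -has_count; apply/hasPn => z zs.
  rewrite -leNgt; move: ys; rewrite path_sortedE; last exact/ge_trans.
  by case/andP => /allP/(_ z zs).
rewrite (permP s_perm) count_map; apply/negP; rewrite -ltnNge.
rewrite -size_filter -(size_map id).
have : {subset [:: i; j] <= [seq k <- enum I | preim r (fun z => y < z) k]}.
  by move=> k; rewrite !inE mem_filter mem_enum andbT /= => /orP[]/eqP ->;
    move: ylt; rewrite lt_min => /andP[].
move/uniq_leq_size; rewrite /= inE ij size_map; exact.
Qed.

Lemma sigma2_ge0 (R : realType) n (P : 'M[R]_n) : 0 <= sigma2 P.
Proof.
rewrite /sigma2; set s := singular_values P.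
have [ls|ls] := ltnP 1 (size s); last by rewrite nth_default.
have : s`_1 \in s by exact: mem_nth.
rewrite {2}/s /singular_values mem_rev => /flattenP[_ /mapP[a _ ->]].
by rewrite mem_nseq => /andP[_ /eqP ->]; exact: sqrtr_ge0.
Qed.

Lemma sorted_flatten_nseq (R : realDomainType) (m : R -> nat) (l : seq R) :
  sorted <%R l -> sorted <=%R (flatten [seq nseq (m a) a | a <- l]).
Proof.
rewrite (sorted_pairwise lt_trans) (sorted_pairwise le_trans).
elim: l => //= a l IH /andP[/allP al /IH ll]; rewrite pairwise_cat ll andbT.
apply/andP; split; last first.
  by elim: (m a) => //= k ->; rewrite andbT; apply/allP => y; rewrite mem_nseq => /andP[_ /eqP ->].
apply/allrelP => x y; rewrite mem_nseq => /andP[_ /eqP ->].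
by move=> /flattenP[_ /mapP[z zl ->]]; rewrite mem_nseq => /andP[_ /eqP ->];
  exact/ltW/al.
Qed.

Lemma min_sqrt_sigma2 (R : realType) n (P : 'M[R]_n) (d : 'I_n -> R) i j :
  char_poly (P^T *m P) = \prod_i ('X - (d i)%:P) -> i != j ->
  Num.min (Num.sqrt (d i)) (Num.sqrt (d j)) <= sigma2 P.
Proof.
move=> pE ij; rewrite /sigma2.
pose s := flatten [seq nseq (mup a (char_poly (P^T *m P))) a
                  | a <- rootsR (char_poly (P^T *m P))].
have sE : singular_values P = rev [seq Num.sqrt x | x <- s].
  rewrite /singular_values /s; elim: (rootsR _) => //= a l IH.
  by rewrite rev_cat IH map_cat rev_cat map_nseq.
apply: (@nth1_sorted_ge _ _ (fun k => Num.sqrt (d k))) => //.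
  rewrite sE rev_sorted.
  apply: (@homo_sorted _ _ _ <=%R <=%R).
    by move=> x y; exact: ler_wsqrtr.
  exact: sorted_flatten_nseq (sorted_roots _ _ _).
rewrite sE perm_rev (map_comp Num.sqrt d); apply: perm_map.
by rewrite /s pE; exact: flatten_mup_prod.
Qed.

Lemma sum_cV1 (R : pzRingType) n (v : 'cV[R]_n) :
  (const_mx 1 : 'rV[R]_n) *m v = (\sum_i v i 0)%:M.
Proof.
apply/matrixP => i j; rewrite !ord1 !mxE eqxx mulr1n.
by apply: eq_bigr => k _; rewrite mxE mul1r.
Qed.

(** The constant vector is fixed by [P^T *m P]. Since [sigma2 P < 1], only one eigendirection [i0]
    can have eigenvalue 1, so the constant vector lies on it and a vector of sum zero has no
    component there; all other eigenvalues are at most [sigma2 P ^+ 2]. *)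
Lemma sigma2_contraction (R : realType) n (P : 'M[R]_n) (v : 'cV[R]_n) :
  doubly_stochastic P -> sigma2 P < 1 -> \sum_i v i 0 = 0 ->
  \sum_i (P *m v) i 0 ^+ 2 <= sigma2 P ^+ 2 * \sum_i v i 0 ^+ 2.
Proof.
case: n P v => [|n] P v [P0 Pr Pc] P1 v0; first by rewrite !big_ord0 mulr0.
pose S := P^T *m P; pose f := real_complex R.
have Ssym : S^T = S by rewrite /S trmx_mul trmxK.
have [U [d [Uu SE]]] := symmetric_spectral Ssym.
have pE := char_poly_spectral Uu SE.
have UU : U ^t* *m U = 1%:M by rewrite -invmx_unitary ?mulVmx ?unitarymx_unit.
pose w1 := U *m (const_mx 1 : 'cV[R[i]]_n.+1); pose w := U *m map_mx f v.
have S1 : S *m (const_mx 1 : 'cV_n.+1) = const_mx 1.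
  have PE (A : 'M[R]_n.+1) : (forall i, \sum_j A i j = 1) ->
      A *m (const_mx 1 : 'cV_n.+1) = const_mx 1.
    move=> A1; apply/colP => i; rewrite !mxE -[RHS](A1 i).
    by apply: eq_bigr => j _; rewrite mxE mulr1.
  rewrite /S -mulmxA !PE// => i; rewrite -[RHS](Pc i).
  by apply: eq_bigr => j _; rewrite mxE.
have USE : U *m map_mx f S = diag_mx (\row_i f (d i)) *m U.
  by rewrite SE !mulmxA (unitarymxP Uu) mul1mx.
have w1d i : (f (d i) - 1) * w1 i 0 = 0.
  have : diag_mx (\row_i f (d i)) *m w1 = w1.
    rewrite /w1 mulmxA -USE -mulmxA; congr (_ *m _).
    have := congr1 (map_mx f) S1; rewrite map_mxM map_const_mx rmorph1.
    by move=> ->.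
  move/colP/(_ i); rewrite mul_diag_mx !mxE => e.
  by rewrite mulrBl mul1r e subrr.
have [i0 w10] : exists i0, w1 i0 0 != 0.
  apply: contrapT => /forallNP w10.
  have : w1 = 0 by apply/colP => i; rewrite [RHS]mxE; apply/eqP/negP => /negP/w10.
  move=> /(congr1 (mulmx (U ^t*))); rewrite mulmx0 /w1 mulmxA UU mul1mx.
  by move=> /colP/(_ 0); rewrite !mxE => /eqP; rewrite oner_eq0.
have d1 i : w1 i 0 != 0 -> d i = 1.
  move=> wi; move/eqP: (w1d i); rewrite mulf_eq0 (negPf wi) orbF subr_eq0.
  by move=> /eqP e; apply: (@complexI R); rewrite [LHS]e.
(* Of the two square roots in [min_sqrt_sigma2], the one at [i0] is 1 and exceeds [sigma2 P], so the
   other one is the minimum. *)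
have ds i : i != i0 -> Num.sqrt (d i) <= sigma2 P.
  move=> ii; have := min_sqrt_sigma2 pE ii.
  by rewrite (d1 i0)// sqrtr1 ge_min [X in _ || X]leNgt P1 orbF.
have w1i i : i != i0 -> w1 i 0 = 0.
  move=> ii; apply/eqP/negPn/negP => /d1 di.
  by have := ds i ii; rewrite di sqrtr1 leNgt P1.
have tcE (A : 'cV[R[i]]_n.+1) i : (A ^t*) 0 i = (A i 0)^* by rewrite !mxE.
(* Orthogonality of [v] to the constant vector, read in the eigenbasis, where [w1] is supported on
   [i0]. *)
have wi0 : w i0 0 = 0.
  have : w1 ^t* *m w = 0.
    rewrite /w1 /w trmx_mul map_mxM mulmxA -[X in X *m _]mulmxA UU mulmx1.
    rewrite trmx_const map_const_mx rmorph1 sum_cV1 (_ : \sum_i _ = 0).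
      by rewrite scalemx0 || rewrite raddf0.
    under eq_bigr do rewrite mxE.
    by rewrite -rmorph_sum v0 rmorph0.
  move/matrixP/(_ 0 0); rewrite mxE (bigD1 i0)//= big1 ?addr0.
    rewrite tcE [RHS]mxE => /eqP; rewrite mulf_eq0 conjC_eq0 (negPf w10).
    by move/eqP.
  by move=> i ii; rewrite tcE w1i// conjC0 mul0r.
have normE (M : 'M[R]_n.+1) : \sum_i (M *m v) i 0 ^+ 2 = (v^T *m (M^T *m M) *m v) 0 0.
  rewrite mulmxA -trmx_mul -mulmxA mxE; apply: eq_bigr => i _.
  by rewrite !mxE expr2.
have fE (M : 'M[R]_n.+1) : f ((v^T *m M *m v) 0 0) =
    ((map_mx f v) ^t* *m map_mx f M *m map_mx f v) 0 0.
  have -> : (map_mx f v) ^t* = map_mx f v^T.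
    by apply/matrixP => i j; rewrite !mxE; exact: conjc_real.
  by rewrite -!map_mxM [RHS]mxE.
have wE : (map_mx f v) ^t* *m U ^t* = w ^t*.
  by rewrite /w trmx_mul map_mxM.
have e1 : f (\sum_i (P *m v) i 0 ^+ 2) = \sum_i f (d i) * `|w i 0| ^+ 2.
  rewrite normE fE SE !mulmxA wE -mulmxA -/w mxE; apply: eq_bigr => i _.
  have -> : (w ^t* *m diag_mx (\row_j f (d j))) 0 i = (w ^t*) 0 i * f (d i).
    by rewrite mul_mx_diag [LHS]mxE [X in _ * X]mxE.
  by rewrite tcE normCK mulrAC mulrC [X in _ * X]mulrC.
have e2 : f (\sum_i v i 0 ^+ 2) = \sum_i `|w i 0| ^+ 2.
  have := normE 1%:M; rewrite mul1mx => ->; rewrite fE trmx1 mul1mx map_mx1.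
  rewrite -UU !mulmxA wE -mulmxA -/w mxE; apply: eq_bigr => i _.
  by rewrite tcE normCK mulrC.
have fM x y : f (x * y) = f x * f y by rewrite /f rmorphM.
suff : f (\sum_i (P *m v) i 0 ^+ 2) <= f (sigma2 P ^+ 2 * \sum_i v i 0 ^+ 2).
  by rewrite lecR.
rewrite fM e1 e2 mulr_sumr; apply: ler_sum => i _.
have [->|ii] := eqVneq i i0; first by rewrite wi0 normr0 expr0n !mulr0.
apply: ler_wpM2r; rewrite ?exprn_ge0// lecR.
have [d0|d0] := leP 0 (d i); last by rewrite (le_trans (ltW d0))// sqr_ge0.
by rewrite -(sqr_sqrtr d0) lerXn2r ?nnegrE ?sqrtr_ge0 ?sigma2_ge0// ds.
Qed.

End singular_values.

(** * Mixing of powers of a doubly stochastic matrix *)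

(** Lagrange's identity: the double sum of squares is twice the Cauchy-Schwarz defect. *)
Lemma cauchy_schwarz_sum (R : realFieldType) (I : finType) (a b : I -> R) :
  (\sum_i a i * b i) ^+ 2 <= (\sum_i a i ^+ 2) * (\sum_i b i ^+ 2).
Proof.
have : 0 <= \sum_i \sum_j (a i * b j - a j * b i) ^+ 2.
  by apply: sumr_ge0 => i _; apply: sumr_ge0 => j _; exact: sqr_ge0.
have -> : \sum_i \sum_j (a i * b j - a j * b i) ^+ 2 =
    2 * ((\sum_i a i ^+ 2) * (\sum_i b i ^+ 2) - (\sum_i a i * b i) ^+ 2).
  transitivity (\sum_i \sum_j (a i ^+ 2 * b j ^+ 2 + b i ^+ 2 * a j ^+ 2
      - 2 * ((a i * b i) * (a j * b j)))).
    by apply: eq_bigr => i _; apply: eq_bigr => j _; ring.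
  under eq_bigr do rewrite sumrB big_split /= -!mulr_sumr.
  rewrite sumrB big_split /= -!mulr_suml -mulr_sumr -mulr_suml.
  by ring.
by rewrite pmulr_rge0// subr_ge0.
Qed.

(** Summation by parts, as an induction on the stronger lower bound [a m] times the last partial sum
    of [c]. *)
Lemma abel_sum_ge0 (R : realDomainType) (a c : nat -> R) (m : nat) :
  (forall t, a t.+1 <= a t) -> (forall t, 0 <= a t) ->
  (forall k, 0 <= \sum_(t < k) c t) -> 0 <= \sum_(t < m) a t * c t.
Proof.
move=> a_ni a0 c0; case: m => [|m]; first by rewrite big_ord0.
apply: (@le_trans _ _ (a m * \sum_(t < m.+1) c t)); first by rewrite mulr_ge0.
elim: m => [|m IH]; first by rewrite !big_ord_recr !big_ord0 /= !add0r.
rewrite big_ord_recr [leRHS]big_ord_recr /= mulrDr lerD2r (le_trans _ IH)//.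
exact: (ler_wpM2r (c0 _) (a_ni m)).
Qed.

(** The increments [k - 2 p], for [p] from 0 to [k], cancel over a full period; within a period the
    partial sums have the form [p (k + 1 - p)] and are never negative. *)
Lemma sum_sawtooth (R : numDomainType) (k m : nat) :
  \sum_(t < m) (k%:R - 2 * (t %% k.+1)%:R) =
    (m %% k.+1)%:R * (k.+1 - m %% k.+1)%:R :> R.
Proof.
elim: m => [|m IH]; first by rewrite big_ord0 mod0n mul0r.
rewrite big_ord_recr /= IH; set p := (m %% k.+1)%N.
have pk : (p <= k)%N by rewrite -ltnS ltn_pmod.
have -> : (m.+1 %% k.+1)%N = if (p == k)%N then 0%N else p.+1.
  rewrite -addn1 -modnDml -/p addn1; case: eqP => [->|pk']; first by rewrite modnn.
  by rewrite modn_small// ltnS ltn_neqAle pk andbT; apply/eqP.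
case: eqP => [->|pk'].
  by rewrite subSn// subnn; ring.
have -> : (k.+1 - p = (k - p).+1)%N by lia.
have -> : (k.+1 - p.+1 = k - p)%N by lia.
by rewrite -!natr1 natrB//; ring.
Qed.

(** Each period of the sawtooth starts with the values below its mean [k], where [a] is largest, so
    non-increasing weights cannot raise the mean above [k]. *)
Lemma sawtooth_sum_le (R : realDomainType) (a : nat -> R) (k m : nat) :
  (forall t, a t.+1 <= a t) -> (forall t, 0 <= a t) ->
  \sum_(t < m) a t * (2 * (t %% k.+1)%:R) <= k%:R * \sum_(t < m) a t.
Proof.
move=> a_ni a0; rewrite -subr_ge0 mulr_sumr -sumrB.
rewrite (eq_bigr (fun t : 'I_m => a t * (k%:R - 2 * (t %% k.+1)%:R))).
  apply: (@abel_sum_ge0 _ a (fun t => k%:R - 2 * (t %% k.+1)%:R)) => // j.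
  by rewrite sum_sawtooth mulr_ge0.
by move=> t _; ring.
Qed.

(* The number of multiples of [k.+1] below [t]. *)
Definition skips (k t : nat) := ((t + k) %/ k.+1)%N.

Lemma skipsP k t :
  (t <= skips k t * k.+1)%N /\ (skips k t * k.+1 <= t + k)%N.
Proof.
rewrite /skips; have := divn_eq (t + k) k.+1; have := ltn_pmod (t + k) (ltn0Sn k).
by move: (_ %/ _)%N (_ %% _)%N => q r; lia.
Qed.

Lemma skips_mono k s t : (s <= t)%N -> (skips k s <= skips k t)%N.
Proof. by move=> st; apply: leq_div2r; rewrite leq_add2r. Qed.

Lemma skips_le k s t : (s <= t)%N -> (skips k t <= skips k s + (t - s))%N.
Proof.
move=> st; have [_ h1] := skipsP k t; have [h2 _] := skipsP k s.
nia.
Qed.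

Lemma skips0 k : skips k 0 = 0%N.
Proof. by rewrite /skips add0n divn_small. Qed.

(* Two skips inside a window leave at least [k] factors between them. *)
Lemma skips_window k s t : (s <= t)%N -> (skips k s + 2 <= skips k t)%N ->
  (k + (skips k t - skips k s) <= t - s)%N.
Proof.
move=> st; have [_ h1] := skipsP k t; have [h2 _] := skipsP k s.
nia.
Qed.

(** The [s] counted are those later than the last skip before [t]: exactly the gradients whose extra
    factor of [P] in [C] no skip has cancelled. *)
Lemma sum_noskip (R : numDomainType) k t :
  \sum_(s < t) (skips k s == skips k t)%:R = (t.-1 %% k.+1)%:R :> R.
Proof.
case: t => [|t] /=; first by rewrite big_ord0 mod0n.
have sE : skips k t.+1 = (t %/ k.+1).+1.
  by rewrite /skips addSnnS -{1}[k.+1]mul1n divnDMl// addn1.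
have bE (s : 'I_t.+1) : (skips k s == skips k t.+1) = (t - s < t %% k.+1)%N.
  have [h1 h2] := skipsP k s; have [h3 h4] := skipsP k t.+1.
  have sq := skips_mono k (ltnW (ltn_ord s)).
  have st : (s <= t)%N by rewrite -ltnS.
  have := divn_eq t k.+1; move: sE; have := ltn_pmod t (ltn0Sn k).
  move: (t %/ _)%N (t %% _)%N => q r rk sE tE; apply/eqP/idP; nia.
under eq_bigr do rewrite bE.
rewrite -natr_sum; congr (_%:R); rewrite (reindex_inj rev_ord_inj) /=.
under eq_bigr => s _ do rewrite subSS subKn ?leq_ord -1?ltnS//.
rewrite -(big_mkord xpredT (fun i => nat_of_bool (i < t %% k.+1)%N)).
rewrite (@big_cat_nat _ _ _ (t %% k.+1))//=; last first.
  by rewrite (leq_trans (leq_mod _ _)).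
rewrite [X in (_ + X)%N]big1_seq ?addn0; last first.
  by move=> i; rewrite mem_index_iota => /andP[_ /andP[ri _]]; rewrite ltnNge ri.
rewrite (eq_big_nat _ _ (F2 := fun=> 1%N)); last by move=> i /andP[_ ->].
by rewrite sum_nat_const_nat subn0 muln1.
Qed.

Section mixing.
Context {R : realType} {n : nat}.
Implicit Types P A B : 'M[R]_n.

Definition rowdist A B (i j : 'I_n) : R := \sum_l `|A i l - B j l|.

Lemma stochastic_exp P k : doubly_stochastic P -> doubly_stochastic (P ^+ k).
Proof.
move=> [P0 Pr Pc]; elim: k => [|k [IH0 IHr IHc]].
  rewrite expr0; split=> [i j|i|j]; first by rewrite mxE; case: eqP.
  - by rewrite (bigD1 i)//= big1 ?mxE ?eqxx ?addr0// => j /negPf ji; rewrite mxE eq_sym ji.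
  - by rewrite (bigD1 j)//= big1 ?mxE ?eqxx ?addr0// => i /negPf ji; rewrite mxE ji.
have PE i j : (P ^+ k.+1) i j = \sum_l P i l * (P ^+ k) l j by rewrite exprS mxE.
split=> [i j|i|j].
- by rewrite PE sumr_ge0// => l _; rewrite mulr_ge0.
- under eq_bigr do rewrite PE.
  rewrite exchange_big /= -[RHS](Pr i); apply: eq_bigr => l _.
  by rewrite -mulr_sumr IHr mulr1.
- under eq_bigr do rewrite PE.
  rewrite exchange_big /= -[RHS](IHc j); apply: eq_bigr => l _.
  by rewrite -mulr_suml Pc mul1r.
Qed.

Lemma rowdist_le2 A B i j : doubly_stochastic A -> doubly_stochastic B ->
  rowdist A B i j <= 2.
Proof.
move=> [A0 Ar _] [B0 Br _].
rewrite (_ : 2 = \sum_l (A i l + B j l)); last by rewrite big_split /= Ar Br.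
by apply: ler_sum => l _; rewrite (le_trans (ler_normB _ _))// !ger0_norm.
Qed.

Variable P : 'M[R]_n.
Hypotheses (P_stoch : doubly_stochastic P) (P_gap : sigma2 P < 1).

Let sqn (v : 'cV[R]_n) := \sum_i v i 0 ^+ 2.

Lemma stochastic_tr_mulmx_sum (v : 'cV[R]_n) :
  \sum_i (P^T *m v) i 0 = \sum_i v i 0.
Proof.
under eq_bigr do rewrite mxE; rewrite exchange_big; apply: eq_bigr => l _ /=.
under eq_bigr do rewrite mxE.
by rewrite -mulr_suml; case: P_stoch => _ -> _; rewrite mul1r.
Qed.

(** With [y = P^T *m v], the contraction of [P] at [y] gives [|y|^2 = <v, P y> <= sigma2 P |v| |y|];
    a division by [|y|] transfers it to the transpose. *)
Lemma sigma2_contraction_tr (v : 'cV[R]_n) : \sum_i v i 0 = 0 ->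
  sqn (P^T *m v) <= sigma2 P ^+ 2 * sqn v.
Proof.
move=> v0; set y := P^T *m v.
have y0 : \sum_i y i 0 = 0 by rewrite stochastic_tr_mulmx_sum.
have yE : sqn y = \sum_i v i 0 * (P *m y) i 0.
  transitivity ((y^T *m y) 0 0).
    by rewrite [RHS]mxE; apply: eq_bigr => i _; rewrite [X in X * _]mxE expr2.
  rewrite {1}/y trmx_mul trmxK -mulmxA mxE.
  by apply: eq_bigr => i _; rewrite [X in X * _]mxE.
have [->|yn] := eqVneq (sqn y) 0.
  by rewrite mulr_ge0 ?sqr_ge0// sumr_ge0// => i _; exact: sqr_ge0.
have yp : 0 < sqn y.
  by rewrite lt_neqAle eq_sym yn sumr_ge0// => i _; exact: sqr_ge0.
rewrite -(ler_pM2r yp) -expr2 {1}yE (le_trans (cauchy_schwarz_sum _ _))//.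
rewrite mulrAC [X in _ <= X]mulrC ler_wpM2l//.
  by rewrite sumr_ge0// => i _; exact: sqr_ge0.
exact: sigma2_contraction.
Qed.

(** Row [i] of [P ^+ k] evolves by [P^T], so its deviation from uniform, of sum zero and initial
    squared length [1 - 1/n], contracts. The factor [sqrt n] is the passage from l2 to l1. *)
Lemma rowdist_uniform k i :
  \sum_l `|(P ^+ k) i l - n%:R^-1| <= sigma2 P ^+ k * Num.sqrt n%:R.
Proof.
have n0 : n%:R != 0 :> R by rewrite pnatr_eq0; case: (n) i => // -[].
pose u m : 'cV[R]_n := \col_l ((P ^+ m) i l - n%:R^-1).
have uS m : u m.+1 = P^T *m u m.
  apply/colP => l; rewrite !mxE exprSr mxE.
  under [in RHS]eq_bigr do rewrite !mxE mulrBr.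
  rewrite sumrB -mulr_suml; case: P_stoch => _ _ ->; rewrite mul1r.
  by congr (_ - _); apply: eq_bigr => j _; rewrite mulrC.
have us m : \sum_l u m l 0 = 0.
  under eq_bigr do rewrite mxE.
  rewrite sumrB sumr_const card_ord -[_^-1 *+ _]mulr_natl divff//.
  by case: (stochastic_exp m P_stoch) => _ -> _; rewrite subrr.
have ub m : sqn (u m) <= (sigma2 P ^+ m) ^+ 2.
  elim: m => [|m IH].
    rewrite expr0 expr1n /sqn.
    under eq_bigr do rewrite !mxE sqrrB.
    rewrite big_split sumrB /= sumr_const card_ord (bigD1 i)//= big1 ?addr0; last first.
      by move=> j /negPf ji; rewrite eq_sym ji expr0n.
    rewrite [X in _ - X](bigD1 i)//= big1 ?addr0; last first.
      by move=> j /negPf ji; rewrite eq_sym ji mul0r mul0rn.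
    rewrite eqxx expr1n mul1r -[_ ^+ 2 *+ _]mulr_natl [n%:R^-1 ^+ 2]expr2 mulrA divff// mul1r.
    by rewrite mulr2n; have := @invr_ge0 R n%:R; rewrite ler0n => /idP; lra.
  rewrite uS (le_trans (sigma2_contraction_tr (us m)))// [sigma2 P ^+ m.+1]exprS exprMn.
  by rewrite ler_wpM2l ?sqr_ge0.
have -> : \sum_l `|(P ^+ k) i l - n%:R^-1| = \sum_l `|u k l 0| * 1.
  by apply: eq_bigr => l _; rewrite !mxE mulr1.
have s0 : 0 <= sigma2 P ^+ k by rewrite exprn_ge0 ?sigma2_ge0.
rewrite -(@ler_pXn2r _ 2)//; last 2 first.
- by rewrite nnegrE sumr_ge0// => l _; rewrite mulr1.
- by rewrite nnegrE mulr_ge0 ?sqrtr_ge0.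
rewrite (le_trans (cauchy_schwarz_sum _ _))// exprMn sqr_sqrtr ?ler0n//.
rewrite expr1n sumr_const card_ord ler_wpM2r ?ler0n//.
under eq_bigr do rewrite real_normK ?num_real//.
exact: ub.
Qed.

End mixing.

Section mixing_time.
Context {R : realType} {n : nat} (P : 'M[R]_n) (T : nat).
Hypotheses (P_stoch : doubly_stochastic P) (P_gap : sigma2 P < 1).
Hypotheses (T_gt0 : (0 < T)%N) (n_gt1 : (1 < n)%N).

Definition mixing_log : R := ln (T%:R * Num.sqrt n%:R) / (1 - sigma2 P).
Definition mixing_time : nat := (Num.truncn mixing_log).+1.
Local Notation K := mixing_time.
(** Exponent of [P] accumulated up to time [t] by the comparison sequence, which omits one factor
    every [K.+1] steps, beginning with the step at time 0. *)
Definition unskipped t := (t - skips K t)%N.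

Lemma mixing_log_ge0 : 0 <= mixing_log.
Proof.
apply: divr_ge0; last by rewrite subr_ge0 ltW.
have n1 : 1 <= Num.sqrt n%:R :> R by rewrite -{1}sqrtr1 ler_wsqrtr// ler1n ltnW.
by rewrite ln_ge0// -[leLHS]mulr1 ler_pM// ler1n.
Qed.

Lemma mixing_timeP : mixing_log <= K%:R <= mixing_log + 1.
Proof.
have /andP[h1 h2] := truncn_itv mixing_log_ge0.
by rewrite /mixing_time (ltW h2) -natr1 lerD2r h1.
Qed.

(** From [sigma2 P <= expR (sigma2 P - 1)]; the exponent [p] is large enough to absorb
    [T sqrt n]. *)
Lemma sigma2_exp_mixed p : (K <= p)%N ->
  sigma2 P ^+ p * Num.sqrt n%:R <= T%:R^-1.
Proof.
move=> Kp; have s0 := sigma2_ge0 P.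
have sn : 0 < Num.sqrt n%:R :> R by rewrite sqrtr_gt0 ltr0n ltnW.
have T0 : 0 < T%:R :> R by rewrite ltr0n.
rewrite -ler_pdivlMr// -invfM.
have : sigma2 P ^+ p <= expR (- (p%:R * (1 - sigma2 P))).
  rewrite -mulrN mulrC expRM_natr lerXn2r ?nnegrE ?expR_ge0//.
  by rewrite (le_trans _ (expR_ge1Dx _))//; lra.
move=> /le_trans; apply.
rewrite -[leRHS]lnK ?posrE ?invr_gt0 ?mulr_gt0// ler_expR lnV ?posrE ?mulr_gt0//.
rewrite lerN2 -ler_pdivrMr ?subr_gt0// (le_trans (andP mixing_timeP).1)//.
by rewrite ler_nat.
Qed.

Lemma rowdist_mixed p q i j : (K <= p)%N -> (K <= q)%N ->
  rowdist (P ^+ p) (P ^+ q) i j <= 2 * T%:R^-1.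
Proof.
move=> Kp Kq.
apply: (@le_trans _ _ (\sum_l (`|(P ^+ p) i l - n%:R^-1| + `|(P ^+ q) j l - n%:R^-1|))).
  by apply: ler_sum => l _; rewrite [X in _ <= _ + X]distrC ler_distD.
rewrite big_split /= mulr2n mulrDl mul1r lerD//;
  by rewrite (le_trans (rowdist_uniform _ _ _ _))// sigma2_exp_mixed.
Qed.

Lemma sum_tail_le t : (t <= T)%N -> \sum_(s < t) (2 * T%:R^-1) <= 2 :> R.
Proof.
move=> tT; rewrite sumr_const card_ord -[_ *+ t]mulr_natr -mulrA ger_pMr//.
by rewrite ler_pdivrMl ?ltr0n// mulr1 ler_nat.
Qed.

(** Lags below [K] cost the trivial distance 2 each; older gradients are mixed and together cost at
    most 2. *)
Lemma sum_rowdist_lag t i j : (t <= T)%N ->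
  \sum_(s < t) rowdist (P ^+ (t.-1 - s)) (P ^+ (t.-1 - s)) i j <= 2 * K%:R + 2.
Proof.
move=> tT; rewrite (reindex_inj rev_ord_inj) /=.
apply: (@le_trans _ _ (\sum_(s < t) (2 * (s < K)%:R + 2 * T%:R^-1))).
  apply: ler_sum => s _.
  have -> : (t.-1 - (t - s.+1) = s)%N by case: t tT s => [_ []//|t _ s] /=; have := ltn_ord s; lia.
  have [sK|sK] := ltnP s K.
    by rewrite mulr1 ler_wpDr// rowdist_le2//; exact: stochastic_exp.
  by rewrite mulr0 add0r rowdist_mixed.
rewrite big_split /= lerD ?sum_tail_le// -mulr_sumr ler_wpM2l// -natr_sum ler_nat.
apply: (@leq_trans (minn t K)); last exact: geq_minr.
elim: (t) => [|m IH]; first by rewrite big_ord0.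
by rewrite big_ord_recr /=; move: IH; case: ltnP; lia.
Qed.

(** Three cases for the number of skips between [s] and [t]. None: the trivial distance 2, for the
    gradients counted by [sum_noskip]. One: the skip cancels the extra factor and the exponents
    agree. At least two: both exponents reach [K] by [skips_window], so both rows are mixed. *)
Lemma sum_rowdist_skip t j : (t <= T)%N ->
  \sum_(s < t) rowdist (P ^+ (t.-1 - s)) (P ^+ (unskipped t - unskipped s)) j j
    <= 2 * (t.-1 %% K.+1)%:R + 2.
Proof.
move=> tT.
apply: (@le_trans _ _ (\sum_(s < t) (2 * (skips K s == skips K t)%:R + 2 * T%:R^-1))).
  apply: ler_sum => s _; have st := ltn_ord s.
  have h1 := skips_mono K (ltnW st); have h2 := skips_le K (ltnW st).
  have h3 := skips_le K (leq0n t); have h4 := skips_le K (leq0n s).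
  rewrite skips0 in h3 h4; rewrite /unskipped.
  have [e|ne] := eqVneq (skips K s) (skips K t).
    rewrite mulr1 ler_wpDr ?mulr_ge0 ?invr_ge0//.
    by rewrite rowdist_le2//; exact: stochastic_exp.
  rewrite mulr0 add0r.
  have [e|ne1] := eqVneq (skips K t) (skips K s).+1.
    have -> : (t - skips K t - (s - skips K s) = t.-1 - s)%N by lia.
    by rewrite /rowdist big1 ?mulr_ge0 ?invr_ge0// => l _; rewrite subrr normr0.
  have := @skips_window K s t (ltnW st); move=> /(_ ltac:(lia)) w.
  by apply: rowdist_mixed; lia.
by rewrite big_split /= lerD ?sum_tail_le// -mulr_sumr sum_noskip.
Qed.

End mixing_time.

(** * Dual norms and proximal steps *)

Section dotp_theory.
Context {R : realType} {d : nat}.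
Implicit Types u v w : 'rV[R]_d.

Lemma dotpC u v : dotp u v = dotp v u.
Proof. by apply: eq_bigr => k _; rewrite mulrC. Qed.

Lemma dotpDl u v w : dotp (u + v) w = dotp u w + dotp v w.
Proof. by rewrite -big_split; apply: eq_bigr => k _; rewrite mxE mulrDl. Qed.

Lemma dotpZl a u v : dotp (a *: u) v = a * dotp u v.
Proof. by rewrite mulr_sumr; apply: eq_bigr => k _; rewrite mxE mulrA. Qed.

Lemma dotpDr u v w : dotp u (v + w) = dotp u v + dotp u w.
Proof. by rewrite !(dotpC u) dotpDl. Qed.

Lemma dotpZr a u v : dotp u (a *: v) = a * dotp u v.
Proof. by rewrite !(dotpC u) dotpZl. Qed.

Lemma dotpNl u v : dotp (- u) v = - dotp u v.
Proof. by rewrite -scaleN1r dotpZl mulN1r. Qed.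

Lemma dotpNr u v : dotp u (- v) = - dotp u v.
Proof. by rewrite !(dotpC u) dotpNl. Qed.

Lemma dotpBl u v w : dotp (u - v) w = dotp u w - dotp v w.
Proof. by rewrite dotpDl dotpNl. Qed.

Lemma dotpBr u v w : dotp u (v - w) = dotp u v - dotp u w.
Proof. by rewrite dotpDr dotpNr. Qed.

Lemma dotp0l u : dotp 0 u = 0.
Proof. by rewrite -(scale0r 0) dotpZl mul0r. Qed.

Lemma dotp0r u : dotp u 0 = 0.
Proof. by rewrite dotpC dotp0l. Qed.

Lemma dotp_suml I (r : seq I) (F : I -> 'rV[R]_d) v :
  dotp (\sum_(i <- r) F i) v = \sum_(i <- r) dotp (F i) v.
Proof.
by elim/big_rec2: _ => [|i x y _ <-]; rewrite ?dotp0l// dotpDl.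
Qed.

Lemma dotp_delta u k : dotp u (delta_mx 0 k) = u 0 k.
Proof.
rewrite /dotp (bigD1 k)//= mxE !eqxx mulr1 big1 ?addr0// => i /negPf ik.
by rewrite mxE ik andbF mulr0.
Qed.

End dotp_theory.

Section norm_theory.
Context {R : realType} {d : nat} (N : 'rV[R]_d -> R).
Hypothesis N_norm : is_norm N.
Implicit Types u v w : 'rV[R]_d.
Local Notation D := (dual_norm N).

Lemma is_normD u v : N (u + v) <= N u + N v. Proof. by case: N_norm. Qed.
Lemma is_normZ a u : N (a *: u) = `|a| * N u. Proof. by case: N_norm. Qed.
Lemma is_norm_eq0 u : N u = 0 -> u = 0. Proof. by case: N_norm => _ _; exact. Qed.
Lemma is_norm0 : N 0 = 0.
Proof. by rewrite -(scale0r 0) is_normZ normr0 mul0r. Qed.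
Lemma is_normN u : N (- u) = N u.
Proof. by rewrite -scaleN1r is_normZ normrN1 mul1r. Qed.
Lemma is_norm_ge0 u : 0 <= N u.
Proof.
have := is_normD u (- u); rewrite subrr is_norm0 is_normN -mulr2n.
by rewrite pmulrn_lge0.
Qed.
Lemma is_normBC u v : N (u - v) = N (v - u).
Proof. by rewrite -opprB is_normN. Qed.
Lemma is_norm_sum I (r : seq I) (F : I -> 'rV[R]_d) :
  N (\sum_(i <- r) F i) <= \sum_(i <- r) N (F i).
Proof.
elim/big_rec2: _ => [|i x y _ h]; first by rewrite is_norm0.
by rewrite (le_trans (is_normD _ _))// lerD2l.
Qed.
Lemma is_norm_ler_dist u v : `|N u - N v| <= N (u - v).
Proof.
rewrite ler_norml; apply/andP; split.
  by rewrite lerNl opprB lerBlDr is_normBC (le_trans _ (is_normD _ _))// subrK.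
by rewrite lerBlDr (le_trans _ (is_normD _ _))// subrK.
Qed.

Lemma is_norm_continuous : continuous N.
Proof.
pose M : R := \sum_k N (delta_mx 0 k).
have M0 : 0 <= M by apply: sumr_ge0 => k _; exact: is_norm_ge0.
have NM u : N u <= M * `|u|.
  rewrite {1}(row_sum_delta u) (le_trans (is_norm_sum _ _))// mulr_suml.
  apply: ler_sum => k _; rewrite is_normZ mulrC ler_wpM2l ?is_norm_ge0//.
  rewrite [leRHS]/Num.norm /= mx_normrE; apply/bigmax_geP; right.
  by exists (0, k).
move=> u; apply/(@cvgrPdist_le _ _ _ (nbhs u) (nbhs_filter u)) => e e0.
near=> v; rewrite (le_trans (is_norm_ler_dist _ _))// (le_trans (NM _))//.
apply: (@le_trans _ _ ((M + 1) * `|u - v|)); first by rewrite ler_wpM2r ?lerDl.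
rewrite -ler_pdivlMl ?ltr_wpDl//; near: v.
by apply: cvgr_dist_le; [exact: cvg_id|rewrite mulr_gt0// invr_gt0 ltr_wpDl].
Unshelve. all: by end_near. Qed.

(** Equivalence of norms: by compactness [N] has a positive minimum on the unit sphere of the sup
    norm. The separate case is dimension 0, where this sphere is empty. *)
Lemma is_norm_coord : exists2 C, 0 <= C & forall u k, `|u 0 k| <= C * N u.
Proof.
have coordE u k : `|u 0 k| <= `|u|.
  by rewrite [leRHS]/Num.norm /= mx_normrE; apply/bigmax_geP; right; exists (0, k).
pose A : set 'rV[R]_d := [set u | `|u| = 1].
have [A0|/set0P/negP/negPn/eqP A0] := pselect (A !=set0); last first.
  exists 0 => // u k; rewrite mul0r normr_le0; apply/negP => /negP u0.
  suff : A (`|u|^-1 *: u) by rewrite A0.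
  rewrite /A /= normrZ normfV normr_id mulVf// normr_eq0.
  by apply: contra u0 => /eqP ->; rewrite mxE.
have cA : compact A.
  apply: bounded_closed_compact.
    by exists 1; split; [exact: real1|move=> y y1 u /= ->; exact: ltW].
  have -> : A = (fun u : 'rV[R]_d => `|u|) @^-1` [set 1] by [].
  apply: closed_comp; last exact: closed_eq.
  by move=> u _; exact: norm_continuous.
have cN : {within A, continuous N}.
  by apply: continuous_subspaceT; exact: is_norm_continuous.
have [c cA' cmin] := EVT_min_rV A0 cA cN.
rewrite inE /A /= in cA'.
have Nc : 0 < N c.
  rewrite lt_neqAle is_norm_ge0 andbT eq_sym; apply/eqP => /is_norm_eq0 c0.
  by move: cA'; rewrite c0 normr0 => /eqP; rewrite eq_sym oner_eq0.
exists (N c)^-1; first by rewrite invr_ge0 ltW.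
move=> u k; rewrite (le_trans (coordE u k))//.
have [->|u0] := eqVneq u 0; first by rewrite normr0 mulr_ge0 ?is_norm_ge0// invr_ge0 ltW.
have nu : 0 < `|u| by rewrite normr_gt0.
have : N c <= N (`|u|^-1 *: u).
  by apply: cmin; rewrite inE /A /= normrZ normfV normr_id mulVf// gt_eqF.
by rewrite is_normZ normfV normr_id -ler_pdivrMl ?invr_gt0// invrK mulrC ler_pdivlMl// mulrC.
Qed.

(** [sup] takes a default value on unbounded sets, so this is what gives [dual_norm] its meaning. *)
Lemma dual_norm_has_ubound v : has_ubound [set dotp v u | u in [set u | N u = 1]].
Proof.
have [C C0 hC] := is_norm_coord; exists (\sum_k `|v 0 k| * C) => _ [u /= u1 <-].
apply: ler_sum => k _; rewrite (le_trans (ler_norm _))// normrM ler_wpM2l//.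
by rewrite (le_trans (hC u k))// u1 mulr1.
Qed.

Lemma dotp_le_dual v u : dotp v u <= D v * N u.
Proof.
have [->|u0] := eqVneq u 0; first by rewrite dotp0r is_norm0 mulr0.
have Nu : 0 < N u.
  by rewrite lt_neqAle is_norm_ge0 andbT eq_sym; apply: contra u0 => /eqP /is_norm_eq0 ->.
rewrite -ler_pdivrMr// mulrC -dotpZr; apply: ub_le_sup.
  exact: dual_norm_has_ubound.
exists ((N u)^-1 *: u) => //=.
by rewrite is_normZ ger0_norm ?invr_ge0 1?ltW// mulVf// gt_eqF.
Qed.

(** The condition [0 <= c] covers dimension 0, where no vector has norm 1 and the [sup] of the empty
    set is 0. *)
Lemma dual_norm_le v c : 0 <= c -> (forall u, N u = 1 -> dotp v u <= c) -> D v <= c.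
Proof.
move=> c0 h; rewrite /dual_norm; set A := (X in sup X).
have [->|A0] := eqVneq A set0; first by rewrite sup0.
by apply: ge_sup; [exact/set0P|move=> _ [u /= u1 <-]; exact: h].
Qed.

Lemma dual_norm_ge0 v : 0 <= D v.
Proof.
have [[u u1]|h] := pselect (exists u, N u = 1).
  have h1 := dotp_le_dual v u; have := dotp_le_dual v (- u).
  by move: h1; rewrite is_normN dotpNr u1; lra.
rewrite /dual_norm (_ : [set _ | _ in _] = set0) ?sup0//.
by rewrite -subset0 => y [u u1 _]; apply: h; exists u.
Qed.

Lemma abs_dotp_le_dual v u : `|dotp v u| <= D v * N u.
Proof.
by rewrite ler_norml dotp_le_dual andbT lerNl -dotpNr -(is_normN u) dotp_le_dual.
Qed.

Lemma dual_normD u v : D (u + v) <= D u + D v.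
Proof.
apply: dual_norm_le => [|w w1]; first by rewrite addr_ge0 ?dual_norm_ge0.
by rewrite dotpDl lerD// (le_trans (dotp_le_dual _ _))// w1 mulr1.
Qed.

Lemma dual_normZ_le a v : D (a *: v) <= `|a| * D v.
Proof.
apply: dual_norm_le => [|w w1]; first by rewrite mulr_ge0 ?dual_norm_ge0.
rewrite dotpZl (le_trans (ler_norm _))// normrM ler_wpM2l//.
by rewrite (le_trans (abs_dotp_le_dual _ _))// w1 mulr1.
Qed.

Lemma dual_norm0 : D 0 = 0.
Proof.
apply/eqP; rewrite eq_le dual_norm_ge0 andbT.
by apply: dual_norm_le => // u _; rewrite dotp0l.
Qed.

Lemma dual_norm_sum I (r : seq I) (F : I -> 'rV[R]_d) :
  D (\sum_(i <- r) F i) <= \sum_(i <- r) D (F i).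
Proof.
elim/big_rec2: _ => [|i x y _ h]; first by rewrite dual_norm0.
by rewrite (le_trans (dual_normD _ _))// lerD2l.
Qed.

Lemma dual_norm_coord : exists2 C, 0 <= C & forall v k, `|v 0 k| <= C * D v.
Proof.
exists (\sum_k N (delta_mx 0 k)); first by rewrite sumr_ge0// => k _; exact: is_norm_ge0.
move=> v k; rewrite -dotp_delta (le_trans (abs_dotp_le_dual _ _))// mulrC.
rewrite ler_wpM2r ?dual_norm_ge0// (bigD1 k)//= lerDl sumr_ge0// => i _.
exact: is_norm_ge0.
Qed.

Lemma dual_norm_row_mulmx n (A : 'M[R]_n) (G : 'M[R]_(n, d)) j :
  D (row j (A *m G)) <= \sum_l `|A j l| * D (row l G).
Proof.
rewrite row_mul mulmx_sum_row (le_trans (dual_norm_sum _ _))//.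
by apply: ler_sum => l _; rewrite mxE (le_trans (dual_normZ_le _ _)).
Qed.

End norm_theory.

(** * Convex combinations and running means *)

Section convexity.
Context {R : realType} {d : nat}.
Implicit Types (x y : 'rV[R]_d) (X : set 'rV[R]_d) (f : 'rV[R]_d -> R).

Lemma convex_set_segment X x y (l : R) : convex_set X -> 0 <= l -> l <= 1 ->
  X x -> X y -> X (l *: x + (1 - l) *: y).
Proof.
move=> cX l0 l1 Xx Xy; have := cX x y (Itv01 l0 l1).
by rewrite !inE; apply.
Qed.

Lemma convex_function_segment f x y (l : R) : convex_function setT f ->
  0 <= l -> l <= 1 -> f (l *: x + (1 - l) *: y) <= l * f x + (1 - l) * f y.
Proof. by move=> cf l0 l1; apply: (cf (Itv01 l0 l1)); rewrite inE. Qed.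

Lemma mean_recr (V : lmodType R) (x : nat -> V) (T : nat) : (0 < T)%N ->
  T.+1%:R^-1 *: \sum_(t < T.+1) x t = T.+1%:R^-1 *: x T +
    (1 - T.+1%:R^-1) *: (T%:R^-1 *: \sum_(t < T) x t).
Proof.
move=> T0; rewrite big_ord_recr /= scalerDr addrC; congr (_ + _).
rewrite scalerA; congr (_ *: _).
have h1 : T.+1%:R != 0 :> R by rewrite pnatr_eq0.
have h2 : T%:R != 0 :> R by rewrite pnatr_eq0 -lt0n.
have h3 : T%:R + 1 != 0 :> R by rewrite natr1.
by rewrite -natr1; field; rewrite h2 h3.
Qed.

Let inv_itv (T : nat) : 0 <= T.+1%:R^-1 :> R /\ T.+1%:R^-1 <= 1 :> R.
Proof. by rewrite invr_ge0 ler0n invf_le1// ler1n. Qed.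

Lemma convex_set_mean X (x : nat -> 'rV[R]_d) (T : nat) : convex_set X ->
  (0 < T)%N -> (forall t, (t < T)%N -> X (x t)) -> X (T%:R^-1 *: \sum_(t < T) x t).
Proof.
move=> cX; case: T => // T _; elim: T => [|T IH] Xx.
  by rewrite big_ord_recr big_ord0 /= add0r invr1 scale1r; exact: Xx.
rewrite mean_recr//; have [h1 h2] := inv_itv T.+1.
apply: convex_set_segment => //; first exact: Xx.
by apply: IH => t tT; apply: Xx; rewrite ltnS ltnW.
Qed.

Lemma convex_function_mean f (x : nat -> 'rV[R]_d) (T : nat) :
  convex_function setT f -> (0 < T)%N ->
  f (T%:R^-1 *: \sum_(t < T) x t) <= T%:R^-1 * \sum_(t < T) f (x t).
Proof.
move=> cf; case: T => // T _; elim: T => [|T IH].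
  by rewrite !big_ord_recr !big_ord0 /= !add0r invr1 scale1r mul1r.
rewrite mean_recr//; have [h1 h2] := inv_itv T.+1.
rewrite (le_trans (convex_function_segment _ _ _ _ _))//.
rewrite [leRHS](@mean_recr R^o (fun t => f (x t)) T.+1 isT) lerD2l.
by apply: ler_wpM2l => //; rewrite subr_ge0.
Qed.

End convexity.

(** * Stability of proximal points and the Fenchel potential *)

Section prox_theory.
Context {R : realType} {d : nat} (N : 'rV[R]_d -> R) (X : set 'rV[R]_d).
Context (psi : 'rV[R]_d -> R).
Hypotheses (N_norm : is_norm N) (X_convex : convex_set X) (X0 : X 0).
Hypotheses (psi_strong : strongly_convex1 N X psi).
Hypotheses (psi_ge0 : forall x, X x -> 0 <= psi x) (psi0 : psi 0 = 0).
Implicit Types x y z c g : 'rV[R]_d.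
Local Notation D := (dual_norm N).

(** Strong convexity at the intermediate point [w], tested against both endpoints with weights [l]
    and [1 - l]: the gradient terms cancel and the quadratic ones add up to [l * (1 - l)]. *)
Lemma strongly_convex_segment x y (l : R) : 0 <= l -> l <= 1 -> X x -> X y ->
  psi (l *: x + (1 - l) *: y) + 2^-1 * (l * (1 - l)) * N (x - y) ^+ 2
    <= l * psi x + (1 - l) * psi y.
Proof.
move=> l0 l1 Xx Xy; set w := l *: x + _.
have Xw : X w by exact: convex_set_segment.
have := psi_strong Xw Xx; have := psi_strong Xw Xy.
have -> : y - w = (- l) *: (x - y).
  by apply/rowP => k; rewrite !mxE; ring.
have -> : x - w = (1 - l) *: (x - y).
  by apply/rowP => k; rewrite !mxE; ring.
have -> : w - y = l *: (x - y) by apply/rowP => k; rewrite !mxE; ring.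
have -> : w - x = (l - 1) *: (x - y) by apply/rowP => k; rewrite !mxE; ring.
rewrite !dotpZr !(is_normZ N_norm) !exprMn.
have -> : `|l - 1| ^+ 2 = (1 - l) ^+ 2.
  by rewrite real_normK ?num_real// -sqrrN opprB.
have -> : `|l| ^+ 2 = l ^+ 2 by rewrite real_normK ?num_real.
move: (psi w) (dotp _ _) (N _ ^+ 2) => p q m h1 h2.
have h3 := ler_wpM2l l0 h2; have l1' : 0 <= 1 - l by lra.
have h4 := ler_wpM2l l1' h1.
have := lerD h3 h4; apply: le_trans; rewrite le_eqVlt; apply/orP; left.
by apply/eqP; field.
Qed.

(** The objective of [prox] with its sign reversed, so that its supremum over [X] is a Fenchel
    conjugate at [- c]. *)
Definition prox_value (a : R) c y : R := - dotp c y - a^-1 * psi y.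

Lemma prox_valueP z a x : prox X psi z a x ->
  X x /\ forall y, X y -> prox_value a z y <= prox_value a z x.
Proof.
move=> [Xx h]; split=> // y /h; rewrite /prox_value; lra.
Qed.

Lemma prox_value_segment a c x y (l : R) : 0 < a -> 0 <= l -> l <= 1 ->
  X x -> X y ->
  l * prox_value a c x + (1 - l) * prox_value a c y
    + l * (1 - l) * (N (x - y) ^+ 2 / (2 * a))
  <= prox_value a c (l *: x + (1 - l) *: y).
Proof.
move=> a0 l0 l1 Xx Xy; have := strongly_convex_segment l0 l1 Xx Xy.
have ai : 0 <= a^-1 by rewrite invr_ge0 ltW.
move=> /(ler_wpM2l ai); rewrite /prox_value dotpDr !dotpZr invfM.
move: (psi _) (psi x) (psi y) (dotp c x) (dotp c y) (N _ ^+ 2) a^-1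
  => p1 p2 p3 q1 q2 m b.
lra.
Qed.

(** Quadratic growth around the optimum: compare [x] with points of the segment towards [y] and let
    these tend to [x]. *)
Lemma prox_growth a z x y : 0 < a -> prox X psi z a x -> X y ->
  prox_value a z y + N (y - x) ^+ 2 / (2 * a) <= prox_value a z x.
Proof.
move=> a0 /prox_valueP[Xx hx] Xy.
set m := _ / _; have m0 : 0 <= m by rewrite divr_ge0 ?sqr_ge0 ?mulr_ge0// ltW.
apply/ler_addgt0Pl => e e0.
(* The limit is replaced by a slack [e]: this weight of [y] makes the error [l * m] at most [e]. *)
pose l := e / (m + e).
have me : 0 < m + e by rewrite ltr_wpDl.
have l0 : 0 < l by rewrite divr_gt0.
have l1 : l <= 1 by rewrite ler_pdivrMr// mul1r lerDr.
have lm : l * m <= e.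
  by rewrite /l mulrAC ler_pdivrMr// ler_pM2l// lerDl ltW.
have := prox_value_segment z a0 (ltW l0) l1 Xy Xx; rewrite -/m.
move=> /le_trans /(_ (hx _ (convex_set_segment X_convex (ltW l0) l1 Xy Xx))).
move=> h; rewrite -(ler_pM2l l0); nra.
Qed.

(** Adding the growth inequalities at [x] and [x'] gives
    [N (x - x') ^+ 2 / a <= <z - z', x' - x>]. *)
Lemma prox_lipschitz a z z' x x' : 0 < a -> prox X psi z a x ->
  prox X psi z' a x' -> N (x - x') <= a * D (z - z').
Proof.
move=> a0 px px'; have [Xx _] := px; have [Xx' _] := px'.
have h1 := prox_growth a0 px Xx'; have h2 := prox_growth a0 px' Xx.
have h3 := dotp_le_dual N_norm (z - z') (x' - x).
move: h1 h3; rewrite (is_normBC N_norm x' x).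
move: h2; rewrite /prox_value dotpBl !dotpBr.
have := is_norm_ge0 N_norm (x - x'); have := dual_norm_ge0 N_norm (z - z').
move: (N _) (D _) => m q q0 m0 h2 h1 h3.
have [->|mn] := eqVneq m 0; first by rewrite mulr_ge0// ltW.
have mp : 0 < m by rewrite lt_neqAle eq_sym mn.
rewrite -(ler_pM2r mp) -mulrA -ler_pdivrMl//.
have -> : a^-1 * (m * m) = m ^+ 2 / (2 * a) + m ^+ 2 / (2 * a).
  by field; rewrite gt_eqF.
lra.
Qed.

(** Growth at [x] tested at the point 0. It makes the iterates square-integrable even if [X] is
    unbounded. *)
Lemma prox_norm_le a z x : 0 < a -> prox X psi z a x -> N x <= 2 * a * D z.
Proof.
move=> a0 px; have [Xx _] := px; have := prox_growth a0 px X0.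
rewrite /prox_value psi0 dotp0r mulr0 oppr0 addr0 add0r sub0r (is_normN N_norm).
have h := dotp_le_dual N_norm z (- x); move: h; rewrite dotpNr (is_normN N_norm).
have := psi_ge0 Xx; have := is_norm_ge0 N_norm x; have := dual_norm_ge0 N_norm z.
have ai : 0 <= a^-1 by rewrite invr_ge0 ltW.
move: (N x) (D z) => m q q0 m0 p0 h1 h2.
have pa : 0 <= a^-1 * psi x by rewrite mulr_ge0.
have [->|mn] := eqVneq m 0; first by rewrite !mulr_ge0// ltW.
have mp : 0 < m by rewrite lt_neqAle eq_sym mn.
rewrite -(ler_pM2r mp) -[2 * a * q * m]mulrA -ler_pdivrMl ?mulr_gt0//.
have -> : (2 * a)^-1 * (m * m) = m ^+ 2 / (2 * a) by rewrite mulrC expr2.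
lra.
Qed.

Definition potential a c : R := sup [set prox_value a c y | y in X].

Section potential_theory.
Context (a : R) (zx xx : 'rV[R]_d).
Hypotheses (a_gt0 : 0 < a) (prox_xx : prox X psi zx a xx).

(** One proximal point [xx], even for another dual vector [zx], suffices: the quadratic growth
    around it dominates the linear perturbation [zx - c]. *)
Lemma potential_ubound c : has_ubound [set prox_value a c y | y in X].
Proof.
exists (prox_value a c xx + a * D (zx - c) ^+ 2 / 2) => _ [y Xy <-].
have := prox_growth a_gt0 prox_xx Xy.
have := dotp_le_dual N_norm (zx - c) (y - xx); rewrite dotpBl !dotpBr.
rewrite /prox_value; move: (N _) (D _) => m q h1 h2.
have : 0 <= (m - a * q) ^+ 2 / (2 * a) by rewrite divr_ge0 ?sqr_ge0// mulr_ge0// ltW.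
have -> : (m - a * q) ^+ 2 / (2 * a) = m ^+ 2 / (2 * a) - q * m + a * q ^+ 2 / 2.
  by field; rewrite gt_eqF.
lra.
Qed.

Lemma potential_ge c y : X y -> prox_value a c y <= potential a c.
Proof.
by move=> Xy; apply: ub_le_sup; [exact: potential_ubound|exists y].
Qed.

Lemma potential_le c u : (forall y, X y -> prox_value a c y <= u) -> potential a c <= u.
Proof.
move=> h; apply: ge_sup; first by exists (prox_value a c 0), 0.
by move=> _ [y Xy <-]; exact: h.
Qed.

Lemma potential0_le0 : potential a 0 <= 0.
Proof.
apply: potential_le => y Xy; rewrite /prox_value dotp0l oppr0 sub0r oppr_le0.
by rewrite mulr_ge0 ?invr_ge0 ?psi_ge0// ltW.
Qed.

Lemma potential_sum n (w : 'I_n -> R) (c : 'I_n -> 'rV[R]_d) :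
  (forall l, 0 <= w l) -> \sum_l w l = 1 ->
  potential a (\sum_l w l *: c l) <= \sum_l w l * potential a (c l).
Proof.
move=> w0 w1; apply: potential_le => y Xy.
rewrite (_ : prox_value a _ y = \sum_l w l * prox_value a (c l) y).
  by apply: ler_sum => l _; rewrite ler_wpM2l// potential_ge.
rewrite /prox_value dotp_suml; under [RHS]eq_bigr do rewrite mulrBr mulrN.
rewrite sumrB sumrN -mulr_suml w1 mul1r; congr (- _ - _).
by apply: eq_bigr => l _; rewrite dotpZl.
Qed.

(* The maximizer at [c] need not exist: instead of it we test the potential at
   the point of the segment from [y] to [xx] at distance [a * D (zx - c)] of
   [xx]. *)
Lemma potential_step c g : potential a (c + g) <=
  potential a c - dotp g xx + a / 2 * D g ^+ 2 + a * D g * D (zx - c).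
Proof.
apply: potential_le => y Xy; have [Xxx _] := prox_xx.
have -> : prox_value a (c + g) y = prox_value a c y - dotp g y.
  by rewrite /prox_value dotpDl; ring.
suff : prox_value a c y + dotp g (xx - y) <=
    potential a c + a / 2 * D g ^+ 2 + a * D g * D (zx - c).
  by rewrite dotpBr; lra.
have := dotp_le_dual N_norm g (xx - y); rewrite (is_normBC N_norm xx y).
have := prox_growth a_gt0 prox_xx Xy.
have := dotp_le_dual N_norm (zx - c) (y - xx).
have := is_norm_ge0 N_norm (y - xx); have := dual_norm_ge0 N_norm (zx - c).
have := dual_norm_ge0 N_norm g.
(* If [y] is itself within the distance [a * D (zx - c)], no move along the segment is needed. *)
have [Nd|dN] := leP (N (y - xx)) (a * D (zx - c)).
  move=> g0 d0 m0 _ _ h; have h1 := potential_ge c Xy.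
  have h2 := ler_wpM2l g0 Nd.
  have h3 : 0 <= a / 2 * D g ^+ 2 by rewrite mulr_ge0 ?sqr_ge0// divr_ge0// ltW.
  move: h2; rewrite mulrCA mulrA; lra.
pose l := 1 - a * D (zx - c) / N (y - xx).
move: dN; have Ny := is_norm_ge0 N_norm (y - xx) => dN g0 d0 m0.
have mp : 0 < N (y - xx) by rewrite (le_lt_trans _ dN)// mulr_ge0// ltW.
have l0 : 0 <= l by rewrite subr_ge0 ler_pdivrMr// mul1r ltW.
have l1 : l <= 1 by rewrite gerBl divr_ge0// mulr_ge0// ltW.
have := prox_value_segment c a_gt0 l0 l1 Xxx Xy.
move=> /le_trans /(_ (potential_ge c (convex_set_segment X_convex l0 l1 Xxx Xy))).
rewrite (is_normBC N_norm xx y) dotpBl !dotpBr.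
have vE : prox_value a c xx - prox_value a c y =
    prox_value a zx xx - prox_value a zx y
    - (dotp zx y - dotp zx xx - (dotp c y - dotp c xx)).
  by rewrite /prox_value; ring.
move: vE mp l0 l1; rewrite {}/l.
move: (N _) (D g) (D _) (prox_value a c xx) (prox_value a c y) (prox_value a zx xx)
  (prox_value a zx y) (dotp zx y) (dotp zx xx) (dotp c y) (dotp c xx) (potential a c)
  (dotp g xx - dotp g y).
move=> m q r v1 v2 v3 v4 p1 p2 p3 p4 po s vE mp l0 l1 h1 h2 h3 h4.
set l := 1 - _ in l0 l1 h1.
have gap : m ^+ 2 / (2 * a) - r * m <= v1 - v2 by lra.
have := ler_wpM2l l0 gap.
(* Moving from [y] to the test point gains at least this square; completing the next one bounds
   [q * m] minus the gain by [a * q * r + a / 2 * q ^+ 2]. *)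
have lE : l * (m ^+ 2 / (2 * a) - r * m) + l * (1 - l) * (m ^+ 2 / (2 * a)) =
    (m - a * r) ^+ 2 / (2 * a).
  by rewrite /l; field; rewrite !gt_eqF.
have : 0 <= (m - a * r - a * q) ^+ 2 / (2 * a).
  by rewrite divr_ge0 ?sqr_ge0// mulr_ge0// ltW.
have -> : (m - a * r - a * q) ^+ 2 / (2 * a) =
    (m - a * r) ^+ 2 / (2 * a) - q * m + a * q * r + a / 2 * q ^+ 2.
  by field; rewrite gt_eqF.
rewrite -lE; move: h1; lra.
Qed.

End potential_theory.

(** Decreasing the step size increases the weight [a^-1] of [psi], which is nonnegative on [X]. *)
Lemma potential_antitone a a' zx xx c : 0 < a' -> a' <= a -> prox X psi zx a xx ->
  potential a' c <= potential a c.
Proof.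
move=> a'0 a'a px; have a0 := lt_le_trans a'0 a'a.
apply: potential_le => y Xy; rewrite (le_trans _ (potential_ge a0 px c Xy))//.
rewrite /prox_value lerB// ler_wpM2r ?psi_ge0// lef_pV2//.
Qed.

End prox_theory.

(** * Regret on a single trajectory *)

Section regret.
Context {R : realType} {n d : nat} (N : 'rV[R]_d -> R) (X : set 'rV[R]_d).
Context (psi : 'rV[R]_d -> R).
Hypotheses (N_norm : is_norm N) (X_convex : convex_set X) (X0 : X 0).
Hypotheses (psi_strong : strongly_convex1 N X psi).
Hypotheses (psi_ge0 : forall x, X x -> 0 <= psi x).
Context (a : nat -> R) (x : 'I_n -> nat -> 'rV[R]_d).
Context (G Z : nat -> 'M[R]_(n, d)).
Hypotheses (a_gt0 : forall t, 0 < a t) (a_noninc : forall t, a t.+1 <= a t).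
Hypothesis (x_prox : forall j t, prox X psi (row j (Z t)) (a t) (x j t)).
Local Notation D := (dual_norm N).

(* Jensen's inequality makes the mean potential insensitive to mixing by any
   doubly stochastic matrix, so the regret is controlled by the distance of
   [Z] to any sequence [C] in which mixing takes place after the gradient
   step. *)
Lemma mixed_regret (C : nat -> 'M[R]_(n, d)) (W : nat -> 'M[R]_n) (T : nat) xs :
  X xs -> C 0 = 0 -> (forall t, doubly_stochastic (W t)) ->
  (forall t, C t.+1 = W t *m (C t + G t)) ->
  \sum_(t < T) \sum_j dotp (row j (G t)) (x j t - xs) <=
    n%:R * ((a T)^-1 * psi xs) +
    \sum_(t < T) \sum_j (a t / 2 * D (row j (G t)) ^+ 2 +
      a t * D (row j (G t)) * D (row j (Z t - C t))).
Proof.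
move=> Xxs C0 Wds CS.
pose V t := \sum_j potential X psi (a t) (row j (C t)).
have V0 : V 0%N <= 0.
  apply: sumr_le0 => j _; rewrite C0 row0.
  exact: (potential0_le0 X0 psi_ge0).
(* One step: shrink the step size, mix by Jensen, regroup the rows by the column sums of [W t], then
   pay for the gradient. *)
have VS t : V t.+1 <= V t + \sum_j (- dotp (row j (G t)) (x j t) +
      (a t / 2 * D (row j (G t)) ^+ 2 +
      a t * D (row j (G t)) * D (row j (Z t - C t)))).
  have [W0 Wr Wc] := Wds t.
  apply: (@le_trans _ _ (\sum_j \sum_l W t j l *
      potential X psi (a t) (row l (C t + G t)))).
    apply: ler_sum => j _.
    apply: (le_trans (potential_antitone N_norm X_convex X0 psi_strong psi_ge0
      _ (a_gt0 _) (a_noninc t) (x_prox j t))).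
    rewrite CS row_mul mulmx_sum_row.
    under eq_bigr do rewrite mxE.
    exact: (potential_sum N_norm X_convex X0 psi_strong (a_gt0 t) (x_prox j t)).
  rewrite exchange_big /= -big_split /=; apply: ler_sum => j _.
  rewrite -mulr_suml Wc mul1r linearD /=.
  apply: (le_trans (potential_step N_norm X_convex X0 psi_strong (a_gt0 t) (x_prox j t) _ _)).
  by rewrite -linearB /= -!addrA.
have VT : - (\sum_(t < T) \sum_j dotp (row j (G t)) xs) - n%:R * ((a T)^-1 * psi xs) <= V T.
  apply: (@le_trans _ _ (\sum_j prox_value psi (a T) (row j (C T)) xs)); last first.
    apply: ler_sum => j _.
    exact: (potential_ge N_norm X_convex psi_strong (a_gt0 T) (x_prox j T)).
  rewrite sumrB sumr_const card_ord mulr_natl lerB//.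
  rewrite sumrN lerN2 le_eqVlt; apply/orP; left; apply/eqP.
  (* Column sums equal to 1 make mixing preserve the sum of the rows, so the rows of [C T] add up to
     the sum of all the gradients. *)
  elim: (T) => [|t IH].
    by rewrite big_ord0 big1// => j _; rewrite C0 row0 dotp0l.
  rewrite big_ord_recr /= -IH -big_split /= CS.
  have [W0 Wr Wc] := Wds t.
  transitivity (\sum_j \sum_l W t j l * dotp (row l (C t + G t)) xs).
    apply: eq_bigr => j _; rewrite row_mul mulmx_sum_row dotp_suml.
    by apply: eq_bigr => l _; rewrite mxE dotpZl.
  rewrite exchange_big; apply: eq_bigr => l _ /=.
  by rewrite -mulr_suml Wc mul1r linearD /= dotpDl.
have VV : V T <= \sum_(t < T) \sum_j (- dotp (row j (G t)) (x j t) +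
      (a t / 2 * D (row j (G t)) ^+ 2 +
      a t * D (row j (G t)) * D (row j (Z t - C t)))).
  elim: (T) => [|t IH]; first by rewrite big_ord0.
  by rewrite big_ord_recr /= (le_trans (VS t))// lerD2r.
have e1 (p q : nat -> 'I_n -> R) : \sum_(t < T) \sum_j (- p t j + q t j) =
    - (\sum_(t < T) \sum_j p t j) + \sum_(t < T) \sum_j q t j.
  rewrite -sumrN -big_split; apply: eq_bigr => t _ /=.
  by rewrite -sumrN -big_split.
have e2 : \sum_(t < T) \sum_j dotp (row j (G t)) (x j t - xs) =
    - (\sum_(t < T) \sum_j dotp (row j (G t)) xs) +
      \sum_(t < T) \sum_j dotp (row j (G t)) (x j t).
  rewrite -(e1 (fun t j => dotp (row j (G t)) xs)
               (fun t j => dotp (row j (G t)) (x j t))).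
  apply: eq_bigr => t _; apply: eq_bigr => j _.
  by rewrite dotpBr addrC.
have := le_trans VT VV; rewrite e2.
rewrite (e1 (fun t j => dotp (row j (G t)) (x j t)) (fun t j =>
  a t / 2 * D (row j (G t)) ^+ 2 + a t * D (row j (G t)) * D (row j (Z t - C t)))).
lra.
Qed.

Hypotheses (Z0 : Z 0%N = 0).

Lemma mixed_sum_recr (P : 'M[R]_n) (u : nat -> nat) (t : nat) :
  (forall s, (s <= t)%N -> (u s <= u t)%N) -> (u t <= u t.+1)%N ->
  \sum_(s < t.+1) P ^+ (u t.+1 - u s) *m G s =
  P ^+ (u t.+1 - u t) *m (\sum_(s < t) P ^+ (u t - u s) *m G s + G t).
Proof.
move=> u_mono utS; rewrite big_ord_recr mulmxDr /=; congr (_ + _).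
rewrite mulmx_sumr; apply: eq_bigr => s _.
rewrite mulmxA -[_ ^+ _ *m _ ^+ _]/(_ ^+ _ * _ ^+ _) -exprD; congr (_ ^+ _ *m _).
have := u_mono s (ltnW (ltn_ord s)); lia.
Qed.

Variable P : 'M[R]_n.
Hypothesis ZS : forall t, Z t.+1 = P *m Z t + G t.

(** A gradient is added after the mixing of its own step, hence the exponent [t.-1 - s] and not
    [t - s]. *)
Lemma mixed_sum t : Z t = \sum_(s < t) P ^+ (t.-1 - s) *m G s.
Proof.
elim: t => [|t IH]; first by rewrite big_ord0.
rewrite ZS big_ord_recr /= subnn expr0 mul1mx; congr (_ + _).
rewrite IH mulmx_sumr; apply: eq_bigr => s _.
rewrite mulmxA -[P *m _]/(P * _) -exprS; congr (_ ^+ _ *m _).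
by case: t s {IH} => [[]//|t s] /=; have := ltn_ord s; lia.
Qed.

Lemma dual_norm_row_sum m (A : 'I_m -> 'M[R]_n) (H : 'I_m -> 'M[R]_(n, d)) j :
  D (row j (\sum_(s < m) A s *m H s)) <=
  \sum_(s < m) \sum_l `|A s j l| * D (row l (H s)).
Proof.
rewrite (raddf_sum (row j)) (le_trans (dual_norm_sum N_norm _ _))//.
by apply: ler_sum => s _; exact: dual_norm_row_mulmx.
Qed.

Lemma prox_consensus i j t : N (x i t - x j t) <=
  a t * \sum_(s < t) \sum_l
    `|(P ^+ (t.-1 - s)) i l - (P ^+ (t.-1 - s)) j l| * D (row l (G s)).
Proof.
apply: (le_trans (prox_lipschitz N_norm X_convex psi_strong (a_gt0 t)
  (x_prox i t) (x_prox j t))).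
rewrite ler_pM2l// mixed_sum.
have -> : row i (\sum_(s < t) P ^+ (t.-1 - s) *m G s) -
          row j (\sum_(s < t) P ^+ (t.-1 - s) *m G s) =
    \sum_(s < t) \sum_l ((P ^+ (t.-1 - s)) i l - (P ^+ (t.-1 - s)) j l) *: row l (G s).
  rewrite !(raddf_sum (row _)) -sumrB; apply: eq_bigr => s _.
  rewrite /= !row_mul !mulmx_sum_row -sumrB; apply: eq_bigr => l _.
  by rewrite !mxE scalerBl.
rewrite (le_trans (dual_norm_sum N_norm _ _))//; apply: ler_sum => s _.
rewrite (le_trans (dual_norm_sum N_norm _ _))//; apply: ler_sum => l _.
exact: dual_normZ_le.
Qed.

Lemma prox_norm_bound j t : psi 0 = 0 -> N (x j t) <=
  2 * a t * \sum_(s < t) \sum_l `|(P ^+ (t.-1 - s)) j l| * D (row l (G s)).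
Proof.
move=> psi0.
apply: (le_trans (prox_norm_le N_norm X_convex X0 psi_strong psi_ge0 psi0
  (a_gt0 t) (x_prox j t))).
by rewrite ler_pM2l ?mulr_gt0// mixed_sum dual_norm_row_sum.
Qed.

(** [mixed_regret] for [W t = P ^+ (u t.+1 - u t)], which is the identity at a skip and [P]
    otherwise; [C] then differs from [Z] only in the exponents. *)
Lemma gossip_regret (T : nat) xs : doubly_stochastic P -> X xs ->
  \sum_(t < T) \sum_j dotp (row j (G t)) (x j t - xs) <=
    n%:R * ((a T)^-1 * psi xs) +
    \sum_(t < T) \sum_j (a t / 2 * D (row j (G t)) ^+ 2 +
      a t * D (row j (G t)) * \sum_(s < t) \sum_l
        `|(P ^+ (t.-1 - s)) j l -
          (P ^+ (unskipped P T t - unskipped P T s)) j l| * D (row l (G s))).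
Proof.
move=> Pds Xxs; set u := unskipped P T.
have u_mono s t : (s <= t)%N -> (u s <= u t)%N.
  move=> st; rewrite /u /unskipped; move: (mixing_time _ _) => k.
  by have := skips_le k st; have := skips_le k (leq0n s); rewrite skips0; lia.
pose C t : 'M[R]_(n, d) := \sum_(s < t) P ^+ (u t - u s) *m G s.
have C0 : C 0%N = 0 by rewrite /C big_ord0.
have CS t : C t.+1 = P ^+ (u t.+1 - u t) *m (C t + G t).
  by apply: mixed_sum_recr => [s|]; exact: u_mono.
have := mixed_regret T Xxs C0 (fun t => stochastic_exp (u t.+1 - u t) Pds) CS.
move=> /le_trans; apply; rewrite lerD2l; apply: ler_sum => t _.
apply: ler_sum => j _; rewrite lerD2l ler_wpM2l ?mulr_ge0 ?dual_norm_ge0 ?(ltW (a_gt0 t))//.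
have -> : Z t - C t =
    \sum_(s < t) (P ^+ (t.-1 - s) - P ^+ (u t - u s)) *m G s.
  rewrite mixed_sum -sumrB; apply: eq_bigr => s _; by rewrite mulmxBl.
apply: (le_trans (dual_norm_row_sum
  (fun s : 'I_t => P ^+ (t.-1 - s) - P ^+ (u t - u s)) (fun s => G s) j)).
by apply: ler_sum => s _; apply: ler_sum => l _; rewrite !mxE.
Qed.

End regret.

(** At [t = 0] no gradient has been received, so only 1/2 remains and the sum with [r] starts at 1.
    Later, replacing [k] by [r + 1] three times adds 3 to [1/2 + 2 + 2]. *)
Lemma weighted_error_sum (R : realFieldType) (a : nat -> R) (k T : nat) (r : R) :
  (forall t, 0 < a t) -> (forall t, a t.+1 <= a t) -> k%:R <= r + 1 -> (0 < T)%N ->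
  \sum_(t < T) a t * (2^-1 + (2 * (t.-1 %% k.+1)%:R + 2) * (t != 0%N :> nat)%:R
     + (2 * k%:R + 2) * (t != 0%N :> nat)%:R)
  <= 15 / 2 * \sum_(t < T) a t + 3 * r * \sum_(1 <= t < T) a t.
Proof.
move=> a_gt0 a_noninc kr; case: T => // m _.
rewrite !big_ord_recl big_add1 big_mkord /= !mulr0 !addr0.
rewrite (eq_bigr (fun t : 'I_m => 9 / 2 * a t.+1 + 2 * k%:R * a t.+1 +
    a t.+1 * (2 * (t %% k.+1)%:R))); last first.
  by move=> t _; rewrite /bump /= add1n /= !mulr1; field.
rewrite [X in _ * (_ + X)](eq_bigr (fun t : 'I_m => a t.+1)); last first.
  by move=> t _; rewrite /bump /= add1n.
rewrite !big_split -!mulr_sumr /=.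
have := @sawtooth_sum_le R (fun t => a t.+1) k m (fun t => a_noninc _)
  (fun t => ltW (a_gt0 _)).
have := a_gt0 0; have s10 : 0 <= \sum_(t < m) a t.+1.
  by apply: sumr_ge0 => t _; exact: ltW.
have := ler_wpM2r s10 kr.
move: s10 (\sum_(t < m) a t.+1 * _) => + s2; lra.
Qed.

(** * Network error and optimality gap along one trajectory *)

Section network_bound.
Context {R : realType} {n : nat} (P : 'M[R]_n) (T : nat) (a : nat -> R).
Context (i : 'I_n) (L : R).
Hypotheses (P_stoch : doubly_stochastic P) (P_gap : sigma2 P < 1).
Hypotheses (T_gt0 : (0 < T)%N) (n_gt1 : (1 < n)%N).
Hypotheses (a_gt0 : forall t, 0 < a t) (a_noninc : forall t, a t.+1 <= a t).

(** Size of the coefficient with which gradient [l] of time [s] enters row [j] of the gap between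
    the iterates and the comparison sequence. *)
Definition regret_weight t s (j l : 'I_n) : R :=
  `|(P ^+ (t.-1 - s)) j l - (P ^+ (unskipped P T t - unskipped P T s)) j l|.

Definition consensus_weight t s (j l : 'I_n) : R :=
  `|(P ^+ (t.-1 - s)) i l - (P ^+ (t.-1 - s)) j l|.

(* The weights of the squared gradient norms [q j t] in the error terms. *)
Definition network_bound (q : 'I_n -> nat -> R) : R :=
  \sum_(t < T) \sum_j (a t / 2 * q j t
    + a t * (\sum_(s < t) \sum_l regret_weight t s j l * ((q j t + q l s) / 2))
    + a t * (\sum_(s < t) \sum_l consensus_weight t s j l * ((L ^+ 2 + q l s) / 2))).

Lemma network_bound_cst :
  network_bound (fun _ _ => L ^+ 2) <= n%:R * L ^+ 2 *
    (15 / 2 * \sum_(t < T) a t + 3 * mixing_log P T * \sum_(1 <= t < T) a t).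
Proof.
pose K := mixing_time P T.
have KP := andP (mixing_timeP P_gap T_gt0 n_gt1).
have L2 : (L ^+ 2 + L ^+ 2) / 2 = L ^+ 2 by field.
pose c t : R := 2^-1 + (2 * (t.-1 %% K.+1)%:R + 2) * (t != 0%N)%:R
                   + (2 * K%:R + 2) * (t != 0%N)%:R.
apply: (@le_trans _ _ (\sum_(t < T) n%:R * (L ^+ 2 * (a t * c t)))).
  apply: ler_sum => t _.
  rewrite (_ : n%:R * _ = \sum_(j < n) L ^+ 2 * (a t * c t)); last first.
    by rewrite sumr_const card_ord mulr_natl.
  apply: ler_sum => j _; rewrite L2.
  under eq_bigr do rewrite -mulr_suml.
  under [X in _ + a t * X <= _]eq_bigr do rewrite -mulr_suml.
  rewrite -!mulr_suml.
  set S1 := \sum_(s < t) _; set S2 := \sum_(s < t) _.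
  suff [h1 h2] : S1 <= (2 * (t.-1 %% K.+1)%:R + 2) * (t != 0%N :> nat)%:R /\
          S2 <= (2 * K%:R + 2) * (t != 0%N :> nat)%:R.
    have -> : a t / 2 * L ^+ 2 + a t * (S1 * L ^+ 2) + a t * (S2 * L ^+ 2) =
      L ^+ 2 * (a t * (2^-1 + S1 + S2)) by ring.
    rewrite ler_wpM2l ?sqr_ge0// ler_pM2l// /c.
    by rewrite lerD// lerD.
  rewrite /S1 /S2; have tT := ltnW (ltn_ord t).
  case: (nat_of_ord t) tT => [|m] tT; first by rewrite !big_ord0 !mulr0.
  rewrite !mulr1; split.
    exact: sum_rowdist_skip.
  exact: sum_rowdist_lag.
have nL : 0 <= n%:R * L ^+ 2 by apply: mulr_ge0; rewrite ?ler0n ?sqr_ge0.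
rewrite -!mulr_sumr mulrA ler_wpM2l//.
exact: (weighted_error_sum a_gt0 a_noninc KP.2 T_gt0).
Qed.

Context {d : nat} (N : 'rV[R]_d -> R) (X : set 'rV[R]_d) (psi : 'rV[R]_d -> R).
Hypotheses (N_norm : is_norm N) (X_convex : convex_set X) (X0 : X 0).
Hypotheses (psi_strong : strongly_convex1 N X psi).
Hypotheses (psi_ge0 : forall x, X x -> 0 <= psi x).
Context (f : 'I_n -> 'rV[R]_d -> R).
Hypothesis (f_convex : forall j, convex_function setT (f j)).
Hypothesis (f_lipschitz :
  forall j x y, X x -> X y -> `|f j x - f j y| <= L * N (x - y)).
Hypothesis (L_ge0 : 0 <= L).
Context (x g : 'I_n -> nat -> 'rV[R]_d) (G Z : nat -> 'M[R]_(n, d)).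
Hypothesis (x_prox : forall j t, prox X psi (row j (Z t)) (a t) (x j t)).
Hypotheses (Z0 : Z 0%N = 0) (ZS : forall t, Z t.+1 = P *m Z t + G t).
Hypothesis (g_sub : forall j t, (t < T)%N -> subdifferential (f j) (x j t) (g j t)).
Local Notation D := (dual_norm N).

Lemma objective_convex : convex_function setT (objective f).
Proof.
move=> t y z yT zT; rewrite /objective.
apply: (@le_trans _ _ (n%:R^-1 * \sum_j (t%:num * f j y + (1 - t%:num) * f j z))).
  by apply: ler_wpM2l; rewrite ?invr_ge0//; apply: ler_sum => j _; exact: f_convex.
rewrite big_split /= -!mulr_sumr mulrDr !(mulrCA n%:R^-1); exact: lexx.
Qed.

(** Each [f j] is moved from [x i t] to [x j t] by the Lipschitz bound, since the subgradient of
    node [j] is taken there; it is then split into the received row of [G] and the noise. AM-GM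
    turns each product of norms into squares. *)
Lemma pathwise_bound xs : X xs ->
  objective f (T%:R^-1 *: \sum_(t < T) x i t) - objective f xs <=
  T%:R^-1 * ((a T)^-1 * psi xs +
    n%:R^-1 * network_bound (fun j t => D (row j (G t)) ^+ 2) +
    n%:R^-1 * \sum_(t < T) \sum_j dotp (g j t - row j (G t)) (x j t - xs)).
Proof.
move=> Xxs; have T0 : 0 < T%:R :> R by rewrite ltr0n.
have n0 : 0 < n%:R :> R by rewrite ltr0n ltnW.
have Xx j t : X (x j t) by case: (x_prox j t).
rewrite -ler_pdivrMl ?invr_gt0// invrK mulrBr.
have h1 : T%:R * objective f (T%:R^-1 *: \sum_(t < T) x i t) <=
    \sum_(t < T) objective f (x i t).
  by rewrite -ler_pdivlMl//; exact: (convex_function_mean _ objective_convex).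
apply: (le_trans (lerB h1 (lexx _))).
have -> : T%:R * objective f xs = \sum_(t < T) objective f xs.
  by rewrite sumr_const card_ord mulr_natl.
rewrite -sumrB.
under eq_bigr do rewrite /objective -mulrBr -sumrB.
rewrite -mulr_sumr ler_pdivrMl// !mulrDr !mulVKf ?lt0r_neq0//.
have h2 t j : (t < T)%N -> f j (x i t) - f j xs <=
    L * N (x i t - x j t) + (dotp (row j (G t)) (x j t - xs)
       + dotp (g j t - row j (G t)) (x j t - xs)).
  move=> tT; rewrite -dotpDl subrKC.
  have s1 := le_trans (ler_norm _) (f_lipschitz j (Xx i t) (Xx j t)).
  have := g_sub j tT xs; rewrite -[xs - x j t]opprB dotpNr.
  lra.
apply: (@le_trans _ _ (\sum_(t < T) \sum_j (L * N (x i t - x j t) +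
    (dotp (row j (G t)) (x j t - xs) + dotp (g j t - row j (G t)) (x j t - xs))))).
  by apply: ler_sum => t _; apply: ler_sum => j _; exact: h2.
have sumD (p q : nat -> 'I_n -> R) : \sum_(t < T) \sum_j (p t j + q t j) =
    \sum_(t < T) \sum_j p t j + \sum_(t < T) \sum_j q t j.
  by rewrite -big_split; apply: eq_bigr => t _ /=; rewrite -big_split.
rewrite (sumD (fun t j => L * N (x i t - x j t)) (fun t j =>
  dotp (row j (G t)) (x j t - xs) + dotp (g j t - row j (G t)) (x j t - xs))).
rewrite (sumD (fun t j => dotp (row j (G t)) (x j t - xs)) (fun t j =>
  dotp (g j t - row j (G t)) (x j t - xs))) addrA lerD2r.
have h3 := gossip_regret N_norm X_convex X0 psi_strong psi_ge0 a_gt0 a_noninc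
  x_prox Z0 ZS T P_stoch Xxs.
apply: (le_trans (lerD (lexx _) h3)).
rewrite addrCA lerD2l -(sumD (fun t j => L * N (x i t - x j t))
  (fun t j => a t / 2 * D (row j (G t)) ^+ 2 + a t * D (row j (G t)) *
    \sum_(s < t) \sum_l regret_weight t s j l * D (row l (G s)))).
apply: ler_sum => t _; apply: ler_sum => j _.
rewrite addrC -addrA -addrA lerD2l.
have at0 := ltW (a_gt0 t).
have amgm (p q : R) : p * q <= (p ^+ 2 + q ^+ 2) / 2.
  by have := sqr_ge0 (p - q); lra.
rewrite lerD//.
  rewrite -mulrA ler_wpM2l// mulr_sumr; apply: ler_sum => s _.
  rewrite mulr_sumr; apply: ler_sum => l _.
  by rewrite mulrCA; apply: ler_wpM2l; [exact: normr_ge0|exact: amgm].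
have h4 := prox_consensus N_norm X_convex psi_strong a_gt0 x_prox Z0 ZS i j t.
apply: (le_trans (ler_wpM2l L_ge0 h4)).
rewrite mulrCA ler_wpM2l// mulr_sumr; apply: ler_sum => s _.
rewrite mulr_sumr; apply: ler_sum => l _.
by rewrite mulrCA; apply: ler_wpM2l; [exact: normr_ge0|exact: amgm].
Qed.

End network_bound.

(** The left side is smaller by half a sum of step sizes and by the term [t = T] of the logarithmic
    sum. *)
Lemma base_bound_ge (R : realType) (n T : nat) (P : 'M[R]_n) (alpha : nat -> R)
    (L v : R) :
  (0 < T)%N -> (1 < n)%N -> sigma2 P < 1 -> (forall t, 0 < alpha t) ->
  T%:R^-1 * ((alpha T)^-1 * v + n%:R^-1 * (n%:R * L ^+ 2 *
    (15 / 2 * \sum_(t < T) alpha t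
     + 3 * mixing_log P T * \sum_(1 <= t < T) alpha t)))
  <= base_bound n L (sigma2 P) alpha v T.
Proof.
move=> T0 n1 P1 a0; rewrite /base_bound.
have n0 : n%:R != 0 :> R by rewrite pnatr_eq0 -lt0n ltnW.
have ml := mixing_log_ge0 P1 T0 n1.
have Ti : 0 <= T%:R^-1 :> R by rewrite invr_ge0.
have s0 : 0 <= \sum_(t < T) alpha t by apply: sumr_ge0 => t _; exact: ltW.
have -> : \sum_(1 <= t < T.+1) alpha t.-1 = \sum_(t < T) alpha t.
  by rewrite big_add1 big_mkord.
have -> : \sum_(1 <= t < T.+1) alpha t = \sum_(1 <= t < T) alpha t + alpha T.
  by rewrite big_nat_recr.
have h1 : 0 <= T%:R^-1 * (L ^+ 2 * \sum_(i < T) alpha i).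
  by apply: mulr_ge0 => //; apply: mulr_ge0 => //; exact: sqr_ge0.
have h2 : 0 <= T%:R^-1 * (L ^+ 2 * (mixing_log P T * alpha T)).
  apply: mulr_ge0 => //; apply: mulr_ge0; first exact: sqr_ge0.
  by apply: mulr_ge0 => //; exact: ltW.
rewrite -/(mixing_log P T) invfM [n%:R^-1 * _]mulrA [n%:R^-1 * _]mulrA mulVf// mul1r.
move: h1 h2; move: (mixing_log P T) (\sum_(t < T) _) (\sum_(1 <= t < T) _) (L ^+ 2)
  T%:R^-1 (alpha T)^-1 (alpha T) => q s1 s2 l2 ti ai aT.
lra.
Qed.

(** * Expectations and conditioning *)

Section integrable_functions.
Context {R : realType} {dO : measure_display} {Omega : measurableType dO}.
Context (mu : probability Omega R).
Implicit Types X Y : Omega -> R.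

Definition L1 X := mu.-integrable setT (EFin \o X).
Local Notation E X := (\int[mu]_w X w).

Lemma L1_measurable X : L1 X -> measurable_fun setT X.
Proof. by move=> /measurable_int /measurable_EFinP. Qed.

Lemma L1_cst (c : R) : L1 (fun=> c).
Proof. exact: finite_measure_integrable_cst. Qed.

Lemma L1D X Y : L1 X -> L1 Y -> L1 (fun w => X w + Y w).
Proof. by move=> h1 h2; apply: eq_integrable (integrableD _ h1 h2). Qed.

Lemma L1Z (c : R) X : L1 X -> L1 (fun w => c * X w).
Proof. by move=> h1; apply: eq_integrable (integrableZl _ c h1). Qed.

Lemma L1N X : L1 X -> L1 (fun w => - X w).
Proof. by move=> /(L1Z (-1)); under [X in L1 X]eq_fun do rewrite mulN1r. Qed.

Lemma L1B X Y : L1 X -> L1 Y -> L1 (fun w => X w - Y w).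
Proof. by move=> h1 h2; exact: L1D h1 (L1N h2). Qed.

Lemma L1_sum I (s : seq I) (F : I -> Omega -> R) :
  (forall i, L1 (F i)) -> L1 (fun w => \sum_(i <- s) F i w).
Proof.
move=> h; elim: s => [|i s IH].
  by under [X in L1 X]eq_fun do rewrite big_nil; exact: L1_cst.
by under [X in L1 X]eq_fun do rewrite big_cons; exact: L1D.
Qed.

Lemma L1_norm X : L1 X -> L1 (fun w => `|X w|).
Proof. exact: integrable_norm. Qed.

Lemma L1_dominated X Y : measurable_fun setT X -> L1 Y ->
  {ae mu, forall w, `|X w| <= Y w} -> L1 X.
Proof.
move=> mX h2 XY; apply/integrableP; split; first exact/measurable_EFinP.
have [mY fY] := integrableP _ _ _ (L1_norm h2).
apply: le_lt_trans fY; apply: ae_ge0_le_integral => //.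
- by apply: measurableT_comp => //; exact/measurable_EFinP.
- exact: measurableT_comp.
- by apply: filterS XY => w h _; rewrite /= !lee_fin normr_id (le_trans h)// ler_norm.
Qed.

Lemma L1_bounded X (c : R) : measurable_fun setT X ->
  {ae mu, forall w, `|X w| <= c} -> L1 X.
Proof. by move=> mX; apply: L1_dominated => //; exact: L1_cst. Qed.

Lemma ExpD X Y : L1 X -> L1 Y -> E (fun w => X w + Y w) = E X + E Y.
Proof. by move=> h1 h2; rewrite RintegralD. Qed.

Lemma ExpB X Y : L1 X -> L1 Y -> E (fun w => X w - Y w) = E X - E Y.
Proof. by move=> h1 h2; rewrite RintegralB. Qed.

Lemma ExpZ (c : R) X : L1 X -> E (fun w => c * X w) = c * E X.
Proof. by move=> h1; rewrite RintegralZl. Qed.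

Lemma Exp_cst (c : R) : E (fun=> c) = c.
Proof. by rewrite Rintegral_cst// [X in fine X](probability_setT mu) mulr1. Qed.

Lemma Exp_sum I (s : seq I) (F : I -> Omega -> R) : (forall i, L1 (F i)) ->
  E (fun w => \sum_(i <- s) F i w) = \sum_(i <- s) E (F i).
Proof.
move=> h; elim: s => [|i s IH].
  by under eq_Rintegral do rewrite big_nil; rewrite Exp_cst big_nil.
under eq_Rintegral do rewrite big_cons.
by rewrite ExpD ?IH ?big_cons//; exact: L1_sum.
Qed.

Lemma Exp_ae_eq X Y : measurable_fun setT X -> measurable_fun setT Y ->
  {ae mu, forall w, X w = Y w} -> E X = E Y.
Proof.
move=> mX mY XY; congr fine; apply: ae_eq_integral => //; try exact/measurable_EFinP.
by apply: filterS XY => w /= -> _.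
Qed.

Lemma Exp_le X Y : L1 X -> L1 Y -> {ae mu, forall w, X w <= Y w} -> E X <= E Y.
Proof.
move=> h1 h2 XY; rewrite -subr_ge0 -ExpB//.
have mX := L1_measurable h1; have mY := L1_measurable h2.
(* Taking the positive part changes [Y - X] on a null set only and makes it nonnegative
   everywhere. *)
rewrite (@Exp_ae_eq _ (fun w => Num.max (Y w - X w) 0)).
- by apply: Rintegral_ge0 => w _; rewrite le_max lexx orbT.
- exact: measurable_funB.
- by apply: measurable_maxr => //; exact: measurable_funB.
- by apply: filterS XY => w h; rewrite max_l// subr_ge0.
Qed.

Lemma Exp_fin X : L1 X -> (\int[mu]_w (X w)%:E)%E = (E X)%:E.
Proof. by move=> h; rewrite fineK// integrable_fin_num. Qed.

Lemma Exp_indicator (A : set Omega) : measurable A ->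
  E (fun w => \1_A w) = fine (mu A).
Proof. by move=> mA; rewrite /Rintegral integral_indic// setIT. Qed.

End integrable_functions.

Section sub_sigma_algebra.
Context {R : realType} {dO : measure_display} {Omega : measurableType dO}.
Context (G : set (set Omega)).
Hypothesis G_sigma : sigma_algebra setT G.
Implicit Types X Y : Omega -> R.
Local Notation T := (g_sigma_algebraType G).

Lemma measurable_wrtP Y :
  measurable_wrt G Y <-> measurable_fun setT (Y : T -> R).
Proof.
have GE : (measurable : set (set T)) = G by exact: measurable_g_measurableTypeE.
split=> [mY _ B mB|mY B mB]; first by rewrite setTI GE; exact: mY.
by have := mY measurableT B mB; rewrite setTI GE.
Qed.

Lemma measurable_wrt_cst (c : R) : measurable_wrt G (fun=> c).
Proof. by apply/measurable_wrtP; exact: measurable_cst. Qed.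

Lemma measurable_wrtM X Y : measurable_wrt G X -> measurable_wrt G Y ->
  measurable_wrt G (fun w => X w * Y w).
Proof.
by move=> /measurable_wrtP h1 /measurable_wrtP h2; apply/measurable_wrtP;
  exact: measurable_funM.
Qed.

Lemma measurable_wrtB X Y : measurable_wrt G X -> measurable_wrt G Y ->
  measurable_wrt G (fun w => X w - Y w).
Proof.
by move=> /measurable_wrtP h1 /measurable_wrtP h2; apply/measurable_wrtP;
  exact: measurable_funB.
Qed.

Lemma measurable_wrt_sum I (s : seq I) (F : I -> Omega -> R) :
  (forall i, measurable_wrt G (F i)) ->
  measurable_wrt G (fun w => \sum_(i <- s) F i w).
Proof.
move=> h; apply/measurable_wrtP; apply: (@measurable_sum _ T R setT I s F) => i.
exact/measurable_wrtP.
Qed.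

Lemma measurable_wrt_comp X (h : R -> R) : measurable_fun setT h ->
  measurable_wrt G X -> measurable_wrt G (fun w => h (X w)).
Proof.
move=> mh /measurable_wrtP mX; apply/measurable_wrtP.
exact: (measurableT_comp mh mX).
Qed.

Lemma measurable_wrt_measurable Y : G `<=` measurable -> measurable_wrt G Y ->
  measurable_fun setT Y.
Proof. by move=> Gm mY _ B mB; rewrite setTI; exact/Gm/mY. Qed.

End sub_sigma_algebra.

Lemma sum_staircase (R : archiRealFieldType) (r : R) (N : nat) : 0 <= r ->
  \sum_(k < N) (k.+1%:R <= r)%R%:R = (minn N (Num.truncn r))%:R :> R.
Proof.
move=> r0; under eq_bigr do rewrite -truncn_ge_nat//.
elim: N => [|N IH]; first by rewrite big_ord0 min0n.
by rewrite big_ord_recr /= IH -natrD; congr (_%:R); case: ltnP; lia.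
Qed.

(** * Conditional expectations tested against measurable weights *)

Section pull_out.
Context {R : realType} {dO : measure_display} {Omega : measurableType dO}.
Context (mu : probability Omega R) (G : set (set Omega)).
Hypotheses (G_sigma : sigma_algebra setT G) (G_meas : G `<=` measurable).
Implicit Types X Y : Omega -> R.
Local Notation E X := (\int[mu]_w X w).

(** For nonnegative [Y], rounds down to a multiple of [1 / (m + 1)] with cap [m + 1], but is written
    with indicators of level sets, because conditional expectations are tested on sets of [G]
    only. *)
Definition staircase (m : nat) (Y : Omega -> R) w : R :=
  \sum_(k < m.+1 * m.+1) m.+1%:R^-1 * \1_[set w | k.+1%:R <= m.+1%:R * Y w] w.

Lemma staircaseE m Y w : 0 <= Y w -> staircase m Y w =
  m.+1%:R^-1 * (minn (m.+1 * m.+1) (Num.truncn (m.+1%:R * Y w)))%:R.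
Proof.
move=> Y0; rewrite /staircase -mulr_sumr; congr (_ * _).
rewrite -sum_staircase ?mulr_ge0//; apply: eq_bigr => k _.
by rewrite indicE; congr ((nat_of_bool _)%:R); apply/idP/idP; rewrite inE.
Qed.

Lemma staircase_itv m Y w : 0 <= Y w -> 0 <= staircase m Y w <= Y w.
Proof.
move=> Y0; rewrite staircaseE//; apply/andP; split; first by rewrite mulr_ge0 ?invr_ge0.
rewrite ler_pdivrMl//.
have /andP[h _] := truncn_itv (mulr_ge0 (ler0n R m.+1) Y0).
by apply: le_trans h; rewrite ler_nat geq_minr.
Qed.

Lemma staircase_cvg Y w : 0 <= Y w -> staircase m Y w @[m --> \oo] --> Y w.
Proof.
move=> Y0; apply/cvgrPdist_le => e e0.
have [N _ NP] := near_infty_natSinv_lt (PosNum e0).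
exists (maxn N (Num.truncn (Y w)).+1) => // m /= Nm.
have me : m.+1%:R^-1 <= e by apply/ltW/NP => /=; rewrite (leq_trans _ Nm)// leq_maxl.
apply: le_trans me.
have /andP[h1 h2] := truncn_itv (mulr_ge0 (ler0n R m.+1) Y0).
have /andP[h3 h4] := truncn_itv Y0.
have Ym : Y w <= m.+1%:R.
  by rewrite (le_trans (ltW h4))// ler_nat leqW// (leq_trans _ Nm)// leq_maxr.
have := staircase_itv m Y0 => /andP[_ h5].
rewrite ger0_norm ?subr_ge0//; move: h5; rewrite staircaseE//.
have -> : minn (m.+1 * m.+1) (Num.truncn (m.+1%:R * Y w)) = Num.truncn (m.+1%:R * Y w).
  by apply/minn_idPr; rewrite -(ler_nat R) (le_trans h1)// natrM ler_wpM2l.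
by move=> _; rewrite lerBlDr -[X in X + _]mulr1 -mulrDr ler_pdivlMl// addrC natr1 ltW.
Qed.

Lemma staircase_level m k Y : measurable_wrt G Y ->
  G [set w | k.+1%:R <= m.+1%:R * Y w].
Proof.
move=> mY; have -> : [set w | k.+1%:R <= m.+1%:R * Y w] =
    (fun w => m.+1%:R * Y w) @^-1` [set` `[k.+1%:R, +oo[%R].
  by apply/seteqP; split => w /=; rewrite in_itv /= andbT.
apply: (measurable_wrtM G_sigma (measurable_wrt_cst G_sigma _) mY).
exact: measurable_itv.
Qed.

Lemma measurable_staircase m Y : measurable_wrt G Y ->
  measurable_fun setT (staircase m Y).
Proof.
move=> mY; apply: measurable_sum => k; apply: measurable_funM => //.
exact/measurable_indic/G_meas/staircase_level.
Qed.

Lemma Exp_staircase m X Y : L1 mu X -> (forall A, G A -> E (fun w => X w * \1_A w) = 0) ->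
  measurable_wrt G Y -> E (fun w => X w * staircase m Y w) = 0.
Proof.
move=> L1X X0 mY.
have GA k := staircase_level m k mY.
have L1k k : L1 mu (fun w => m.+1%:R^-1 * (X w * \1_[set w | k.+1%:R <= m.+1%:R * Y w] w)).
  apply: L1Z; apply: (L1_dominated _ (L1_norm L1X)).
    apply: measurable_funM; first exact: L1_measurable L1X.
    exact/measurable_indic/G_meas.
  by apply: aeW => w; rewrite normrM ler_piMr// indicE; case: (_ \in _);
    rewrite ?normr1 ?normr0.
transitivity (E (fun w => \sum_(k < m.+1 * m.+1) m.+1%:R^-1 *
    (X w * \1_[set w | k.+1%:R <= m.+1%:R * Y w] w))).
  apply: eq_Rintegral => w _; rewrite mulr_sumr; apply: eq_bigr => k _.
  by rewrite mulrCA.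
rewrite Exp_sum; last by move=> k; exact: L1k.
rewrite big1// => k _; rewrite ExpZ ?X0 ?mulr0//.
by have := L1Z m.+1%:R (L1k k); under [X in L1 _ X]eq_fun do rewrite mulVKf//.
Qed.

(** Vanishing on indicators extends to staircases by linearity, and to [Y] by dominated convergence
    with the dominating function [|X * Y|]. *)
Lemma Exp_pull_out_ge0 X Y : L1 mu X -> (forall A, G A -> E (fun w => X w * \1_A w) = 0) ->
  measurable_wrt G Y -> (forall w, 0 <= Y w) -> L1 mu (fun w => X w * Y w) ->
  E (fun w => X w * Y w) = 0.
Proof.
move=> L1X X0 mY Y0 L1XY.
have mX := L1_measurable L1X.
have mst m := measurable_staircase m mY.
have [] := @dominated_convergence _ Omega R mu setT measurableT
  (fun m w => (X w * staircase m Y w)%:E) (fun w => (X w * Y w)%:E)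
  (fun w => `|X w * Y w|%:E).
- by move=> m; apply/measurable_EFinP; exact: measurable_funM.
- by apply/measurable_EFinP; exact: L1_measurable L1XY.
- apply: aeW => w _; apply: cvg_EFin; first by near=> m.
  by apply: cvgMr; exact: staircase_cvg.
- exact: L1_norm.
- apply: aeW => w m _; rewrite /= lee_fin !normrM ler_wpM2l//.
  by have /andP[h1 h2] := staircase_itv m (Y0 w); rewrite !ger0_norm.
move=> _ _ h.
have hE : [sequence (\int[mu]_(w in setT) (X w * staircase m Y w)%:E)%E]_m = fun=> 0%:E.
  apply/funext => m /=; rewrite Exp_fin ?Exp_staircase//.
  apply: (L1_dominated _ (L1_norm L1XY)); first exact: measurable_funM.
  apply: aeW => w; rewrite !normrM ler_wpM2l//.
  by have /andP[h1 h2] := staircase_itv m (Y0 w); rewrite !ger0_norm.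
rewrite hE Exp_fin// in h.
exact: (EFin_inj (cvg_unique (@ereal_hausdorff R) h (cvg_cst _))).
Unshelve. all: by end_near. Qed.

Lemma Exp_pull_out X Y : L1 mu X -> (forall A, G A -> E (fun w => X w * \1_A w) = 0) ->
  measurable_wrt G Y -> L1 mu (fun w => X w * Y w) ->
  E (fun w => X w * Y w) = 0.
Proof.
move=> L1X X0 mY L1XY.
(* The positive and the negative part of [Y] are treated together, as the signs [s = 1] and
   [s = -1]. *)
have part0 s : (s = 1 \/ s = -1) -> E (fun w => X w * Num.max (s * Y w) 0) = 0 /\
    L1 mu (fun w => X w * Num.max (s * Y w) 0).
  move=> s1; set p := fun w => Num.max (s * Y w) 0.
  have mp : measurable_wrt G p.
    apply: (measurable_wrt_comp G_sigma (h := fun y => Num.max (s * y) 0)) mY.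
    by apply: measurable_maxr => //; exact: measurable_funM.
  have L1p : L1 mu (fun w => X w * p w).
    apply: (L1_dominated _ (L1_norm L1XY)).
      apply: measurable_funM; first exact: L1_measurable L1X.
      exact: measurable_wrt_measurable mp.
    apply: aeW => w; rewrite !normrM ler_wpM2l// /p; case: s1 => ->.
      rewrite mul1r; case: (leP (Y w) 0) => Yw; first by rewrite normr0.
      by [].
    rewrite mulN1r; case: (leP (- Y w) 0) => Yw; first by rewrite normr0.
    by rewrite normrN.
  split=> //; apply: Exp_pull_out_ge0 => // w.
  by rewrite /p le_max lexx orbT.
have [e1 l1] := part0 1 (or_introl erefl).
have [e2 l2] := part0 (-1) (or_intror erefl).
transitivity (E (fun w => X w * Num.max (1 * Y w) 0 - X w * Num.max (-1 * Y w) 0)).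
  apply: eq_Rintegral => w _; rewrite -mulrBr mul1r mulN1r; congr (_ * _).
  by case: (leP (Y w) 0) => Yw; case: (leP (- Y w) 0) => Yw'; lra.
by rewrite ExpB// e1 e2 subrr.
Qed.

End pull_out.

Section conditional_expectation.
Context {R : realType} {dO : measure_display} {Omega : measurableType dO}.
Context (mu : probability Omega R) (G : set (set Omega)).
Hypotheses (G_sigma : sigma_algebra setT G) (G_meas : G `<=` measurable).
Implicit Types X Y Z : Omega -> R.
Local Notation E X := (\int[mu]_w X w).

Lemma Exp_restrict X (A : set Omega) :
  E (fun w => X w * \1_A w) = fine (\int[mu]_(w in A) (X w)%:E).
Proof.
rewrite -/(Rintegral mu A X) [RHS]Rintegral_mkcond; apply: eq_Rintegral => w _.
by rewrite patchE indicE; case: (w \in A); rewrite ?mulr1 ?mulr0.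
Qed.

Lemma Exp_cond_exp_pull_out X Z Y : is_cond_exp mu G X Z -> measurable_wrt G Y ->
  L1 mu (fun w => (X w - Z w) * Y w) -> E (fun w => (X w - Z w) * Y w) = 0.
Proof.
move=> [L1X L1Z mZ XZ] mY L1XY.
apply: (Exp_pull_out G_sigma G_meas (L1B L1X L1Z)) => // A GA.
have L1A V : L1 mu V -> L1 mu (fun w => V w * \1_A w).
  move=> L1V; apply: (L1_dominated _ (L1_norm L1V)).
    apply: measurable_funM; first exact: L1_measurable L1V.
    exact/measurable_indic/G_meas.
  by apply: aeW => w; rewrite normrM ler_piMr// indicE; case: (_ \in _);
    rewrite ?normr1 ?normr0.
transitivity (E (fun w => X w * \1_A w - Z w * \1_A w)).
  by apply: eq_Rintegral => w _; rewrite mulrBl.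
by rewrite ExpB; [rewrite !Exp_restrict XZ// subrr|exact: L1A|exact: L1A].
Qed.

Lemma Exp_le_cond_exp X (c : R) : cond_exp_le mu G X c -> L1 mu X /\ E X <= c.
Proof.
move=> [Y [L1X L1Y mY XY] Yc]; split=> //.
have GT : G setT by case: G_sigma => G0 GC _; rewrite -(setD0 setT); exact: GC.
rewrite [E X](congr1 fine (esym (XY _ GT))) -(Exp_cst mu c).
exact: (Exp_le L1Y (L1_cst _ _)).
Qed.

End conditional_expectation.

(** * Measurability of Lipschitz functions of random vectors *)

Section measurable_lipschitz.
Context {R : realType} {dO : measure_display} {Omega : measurableType dO}.
Context {d : nat} (N : 'rV[R]_d -> R) (X : set 'rV[R]_d) (f : 'rV[R]_d -> R) (L : R).
Hypotheses (N_norm : is_norm N).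
Hypothesis (f_lipschitz : forall x y, X x -> X y -> `|f x - f y| <= L * N (x - y)).
Context (V : Omega -> 'rV[R]_d).
Hypotheses (V_X : forall w, X (V w)).
Hypotheses (V_meas : forall k, measurable_fun setT (fun w => V w 0 k)).

(** Rounding to a grid of mesh [1 / (m + 1)]: there are countably many cells, and [rep] chooses a
    point of [X] in each. The default 0 of [xget] is never reached at a cell containing some
    [V w]. *)
Let cell (m : nat) (y : 'rV[R]_d) : 'rV[int]_d := \row_k Num.floor (m.+1%:R * y 0 k).
Let rep (m : nat) (t : 'rV[int]_d) : 'rV[R]_d := xget 0 [set y | X y /\ cell m y = t].

Let rep_cell m w : X (rep m (cell m (V w))) /\
  forall k, `|rep m (cell m (V w)) 0 k - V w 0 k| <= m.+1%:R^-1.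
Proof.
have [] : [set y | X y /\ cell m y = cell m (V w)] (rep m (cell m (V w))).
  by apply: xgetPex; exists (V w).
set y := rep _ _ => Xy yV; split=> // k; move: yV => /rowP/(_ k); rewrite !mxE => yV.
have m0 : 0 < m.+1%:R :> R by [].
have /andP[h1 h2] := floor_itv (m.+1%:R * y 0 k).
have /andP[h3 h4] := floor_itv (m.+1%:R * V w 0 k).
rewrite yV in h1 h2; rewrite -(ler_pM2l m0) mulfV ?gt_eqF// -(ger0_norm (ltW m0)) -normrM.
rewrite mulrBr ler_norml; move: h1 h2 h3 h4; rewrite intrD; lra.
Qed.

Let cell_meas m t : measurable [set w | cell m (V w) = t].
Proof.
have -> : [set w | cell m (V w) = t] = \bigcap_(k in [set: 'I_d])
    ((fun w => m.+1%:R * V w 0 k) @^-1` [set` `[(t 0 k)%:~R, (t 0 k + 1)%:~R[%R]).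
  apply/seteqP; split=> w /=.
    by move=> <- k _ /=; rewrite mxE in_itv /= floor_itv.
  move=> h; apply/rowP => k; rewrite mxE; have := h k I; rewrite /= in_itv /=.
  exact: floor_def.
apply: fin_bigcap_measurable => // k _; rewrite -[X in measurable X]setTI.
have mf : measurable_fun setT (fun w => m.+1%:R * V w 0 k) by exact: measurable_funM.
by apply: mf => //; exact: measurable_itv.
Qed.

(** [f] is controlled on [X] only, so it is evaluated at the points [rep] of [X]; the resulting
    functions of [w] take countably many values, are measurable and converge by the Lipschitz
    bound. *)
Lemma measurable_lipschitz_comp : measurable_fun setT (fun w => f (V w)).
Proof.
apply: (@measurable_fun_cvg _ _ _ setT (fun m w => f (rep m (cell m (V w))))).
  move=> m _ B mB; rewrite setTI.
  have -> : (fun w => f (rep m (cell m (V w)))) @^-1` B =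
      \bigcup_(t : 'rV[int]_d) ([set w | cell m (V w) = t] `&` [set _ | B (f (rep m t))]).
    apply/seteqP; split=> w /=; first by exists (cell m (V w)).
    by move=> [t _ [<-]].
  apply: countable_bigcupT_measurable; first exact: countableP.
  move=> t; have [Bt|Bt] := pselect (B (f (rep m t))).
    by rewrite (_ : [set _ | B _] = setT) ?setIT//; apply/seteqP; split.
  by rewrite (_ : [set _ | B _] = set0) ?setI0//; apply/seteqP; split.
move=> w _; apply/cvgrPdist_le => e e0.
pose C := `|L| * \sum_k N (delta_mx 0 k) + 1.
have C0 : 0 < C.
  by rewrite ltr_wpDl// mulr_ge0// sumr_ge0// => k _; exact: is_norm_ge0.
have eC : 0 < e / C by rewrite divr_gt0.
near=> m; have [Xr rV] := rep_cell m w.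
rewrite distrC (le_trans (f_lipschitz Xr (V_X w)))//.
apply: (@le_trans _ _ (`|L| * (m.+1%:R^-1 * \sum_k N (delta_mx 0 k)))).
  apply: (@le_trans _ _ (`|L| * N (rep m (cell m (V w)) - V w))).
    by rewrite ler_wpM2r ?ler_norm ?is_norm_ge0.
  rewrite ler_wpM2l// (row_sum_delta (_ - _)) (le_trans (is_norm_sum N_norm _ _))//.
  rewrite mulr_sumr; apply: ler_sum => k _; rewrite is_normZ// ler_wpM2r ?is_norm_ge0//.
  by rewrite !mxE.
rewrite mulrCA; apply: (@le_trans _ _ (m.+1%:R^-1 * C)).
  by rewrite ler_wpM2l// lerDl.
rewrite -ler_pdivlMr//; apply/ltW; near: m.
exact: (near_infty_natSinv_lt (PosNum eC)).
Unshelve. all: by end_near. Qed.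

End measurable_lipschitz.

(** * Bernstein's inequality for bounded martingale differences *)

Lemma expR_le_quadratic (R : realType) (x : R) : `|x| <= 2 / 3 ->
  expR x <= 1 + x + x ^+ 2.
Proof.
rewrite ler_norml => /andP[x1 x2].
(* A polynomial lower bound for [expR (- x)] reduces the claim to [(1 + x + x^2) (1 - x/4)^4 >= 1],
   a polynomial inequality on the interval. *)
have h : (1 - x / 4) ^+ 4 <= expR (- x).
  have -> : - x = (- (x / 4)) * 4%:R by field.
  rewrite expRM_natr lerXn2r ?nnegrE ?expR_ge0//; first by lra.
  exact: expR_ge1Dx.
have p0 : 0 <= 1 + x + x ^+ 2 by have := sqr_ge0 (x + 2^-1); lra.
have h2 : 1 <= (1 + x + x ^+ 2) * (1 - x / 4) ^+ 4.
  rewrite -subr_ge0.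
  have -> : (1 + x + x ^+ 2) * (1 - x / 4) ^+ 4 - 1 =
    x ^+ 2 * (3 / 8 - 11 / 16 * x + 81 / 256 * x ^+ 2 - 15 / 256 * x ^+ 3 + x ^+ 4 / 256).
    by field.
  rewrite mulr_ge0 ?sqr_ge0//.
  have [xn|xp] := leP x 0.
    have := sqr_ge0 x; have := sqr_ge0 (x ^+ 2); have : x ^+ 3 <= 0.
      by rewrite exprS mulr_le0_ge0// sqr_ge0.
    rewrite -exprM; lra.
  have h3 : x ^+ 3 <= 4 / 9 * x.
    have : x ^+ 2 <= 4 / 9 by nra.
    by move=> /(ler_wpM2r (ltW xp)); rewrite -exprSr.
  have := sqr_ge0 (x - 2 / 3); have := sqr_ge0 (x ^+ 2); rewrite -exprM; lra.
have ep := expR_gt0 (- x).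
rewrite -[x in expR x]opprK expRN -[leLHS]mul1r ler_pdivrMr// (le_trans h2)//.
exact: ler_wpM2l.
Qed.

Section bernstein.
Context {R : realType} {dO : measure_display} {Omega : measurableType dO}.
Context (mu : probability Omega R) (F : nat -> set (set Omega)).
Hypotheses (F_filtration : filtration F).
Context (D : nat -> Omega -> R) (c v : R).
Local Notation E X := (\int[mu]_w X w).
Hypotheses (c_ge0 : 0 <= c) (v_ge0 : 0 <= v).
Hypothesis D_meas : forall t, measurable_wrt (F t.+1) (D t).
Hypothesis D_bound : forall t, {ae mu, forall w, `|D t w| <= c}.
(** Weak form of a vanishing conditional mean, and below of a conditional variance at most [v]: only
    bounded nonnegative weights are tested, such as [expR (theta * S t)]. *)
Hypothesis D_mean : forall t (Y : Omega -> R) M, measurable_wrt (F t) Y ->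
  (forall w, 0 <= Y w) -> {ae mu, forall w, Y w <= M} ->
  E (fun w => Y w * D t w) = 0.
Hypothesis D_var : forall t (Y : Omega -> R) M, measurable_wrt (F t) Y ->
  (forall w, 0 <= Y w) -> {ae mu, forall w, Y w <= M} ->
  E (fun w => Y w * D t w ^+ 2) <= v * E Y.

Let F_sigma t : sigma_algebra setT (F t). Proof. by case: F_filtration. Qed.
Let F_meas t : F t `<=` measurable. Proof. by case: F_filtration. Qed.

Let S T w := \sum_(t < T) D t w.

Let D_measF s t : (s < t)%N -> measurable_wrt (F t) (D s).
Proof.
case: F_filtration => _ _ FS st B mB; apply: (FS s.+1 t st); exact: D_meas.
Qed.

Let S_meas T : measurable_wrt (F T) (S T).
Proof. by apply: measurable_wrt_sum => // t; apply: D_measF. Qed.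

Let S_bound T : {ae mu, forall w, `|S T w| <= T%:R * c}.
Proof.
have h : {ae mu, forall w t, `|D t w| <= c} by apply/ae_foralln.
apply: filterS h => w h; rewrite (le_trans (ler_norm_sum _ _ _))//.
rewrite (le_trans (ler_sum _ (fun (t : 'I_T) _ => h t)))//.
by rewrite sumr_const card_ord mulr_natl.
Qed.

(** Induction on [T]: the previous exponential is an admissible weight. The linear term of the new
    factor has mean zero, and the quadratic one leaves [1 + theta ^+ 2 * v <= expR (theta ^+ 2 *
    v)]. *)
Lemma martingale_mgf (theta : R) (T : nat) : 0 <= theta -> theta * c <= 2 / 3 ->
  L1 mu (fun w => expR (theta * S T w)) /\
  E (fun w => expR (theta * S T w)) <= expR (T%:R * (theta ^+ 2 * v)).
Proof.
move=> th0 thc.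
have Y_meas t : measurable_wrt (F t) (fun w => expR (theta * S t w)).
  apply: (measurable_wrt_comp (F_sigma t) (h := fun y => expR (theta * y))) => //.
  by apply: measurableT_comp => //; exact: measurable_funM.
have Y_bound t : {ae mu, forall w, expR (theta * S t w) <= expR (theta * (t%:R * c))}.
  apply: filterS (S_bound t) => w h; rewrite ler_expR ler_wpM2l//.
  by rewrite (le_trans (ler_norm _)).
have L1Y t : L1 mu (fun w => expR (theta * S t w)).
  apply: (L1_bounded (c := expR (theta * (t%:R * c)))).
    exact: measurable_wrt_measurable (Y_meas t).
  by apply: filterS (Y_bound t) => w h; rewrite ger0_norm ?expR_ge0.
split=> //; elim: T => [|T IH].
  rewrite mul0r expR0 -[leRHS](Exp_cst mu 1) le_eqVlt; apply/orP; left; apply/eqP.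
  by apply: eq_Rintegral => w _; rewrite /S big_ord0 mulr0 expR0.
pose Y w := expR (theta * S T w).
have mD : measurable_fun setT (D T) := measurable_wrt_measurable (F_meas (t := T.+1)) (D_meas T).
have mY : measurable_fun setT Y := L1_measurable (L1Y T).
pose M := expR (theta * (T%:R * c)).
have M0 : 0 <= M by exact: expR_ge0.
have L1YD : L1 mu (fun w => Y w * D T w).
  apply: (L1_bounded (c := M * c)); first exact: measurable_funM.
  apply: filterS2 (Y_bound T) (D_bound T) => w h1 h2.
  by rewrite normrM ler_pM// ger0_norm ?expR_ge0.
have L1YD2 : L1 mu (fun w => Y w * D T w ^+ 2).
  apply: (L1_bounded (c := M * c ^+ 2)).
    by apply: measurable_funM => //; exact: measurable_funX.
  apply: filterS2 (Y_bound T) (D_bound T) => w h1 h2.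
  rewrite normrM normrX; apply: ler_pM => //.
    by rewrite ger0_norm ?expR_ge0.
  by rewrite lerXn2r// nnegrE.
have le1 : E (fun w => expR (theta * S T.+1 w)) <=
    E (fun w => Y w + theta * (Y w * D T w) + theta ^+ 2 * (Y w * D T w ^+ 2)).
  apply: Exp_le => //.
    exact: L1D (L1D (L1Y T) (L1Z theta L1YD)) (L1Z (theta ^+ 2) L1YD2).
  apply: filterS (D_bound T) => w h.
  have -> : S T.+1 w = S T w + D T w by rewrite /S big_ord_recr.
  rewrite mulrDr expRD -/(Y w).
  have -> : Y w + theta * (Y w * D T w) + theta ^+ 2 * (Y w * D T w ^+ 2) =
    Y w * (1 + theta * D T w + (theta * D T w) ^+ 2) by ring.
  apply: ler_wpM2l; first exact: expR_ge0.
  apply: expR_le_quadratic; rewrite normrM ger0_norm// (le_trans _ thc)//.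
  exact: ler_wpM2l.
apply: (le_trans le1).
rewrite (ExpD (L1D (L1Y T) (L1Z theta L1YD)) (L1Z (theta ^+ 2) L1YD2)).
rewrite (ExpD (L1Y T) (L1Z theta L1YD)) (ExpZ _ L1YD) (ExpZ _ L1YD2).
rewrite (D_mean (Y_meas T) (fun w => expR_ge0 _) (Y_bound T)) mulr0 addr0.
have h := D_var (Y_meas T) (fun w => expR_ge0 _) (Y_bound T).
rewrite -/Y in h.
have EY0 : 0 <= E Y by apply: Rintegral_ge0 => w _; exact: expR_ge0.
have thv0 : 0 <= theta ^+ 2 * v by rewrite mulr_ge0 ?sqr_ge0.
apply: (@le_trans _ _ (E Y * expR (theta ^+ 2 * v))).
  apply: (@le_trans _ _ (E Y * (1 + theta ^+ 2 * v))).
    rewrite mulrDr mulr1 lerD2l [leRHS]mulrCA [X in _ <= _ * X]mulrC.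
    by apply: ler_wpM2l => //; exact: sqr_ge0.
  by rewrite ler_wpM2l// expR_ge1Dx.
rewrite -natr1 mulrDl mul1r expRD ler_wpM2r ?expR_ge0//.
Qed.

(** Chernoff's bound. [A] is only required to contain the event of a small sum almost surely, so
    that a pathwise inequality can be inserted. *)
Lemma bernstein_tail (T : nat) (delta : R) (A : set Omega) :
  (0 < c -> 0 < v) -> (0 < T)%N -> 0 < delta < 1 -> measurable A ->
  {ae mu, forall w, S T w <= 2 * Num.sqrt (T%:R * v * ln delta^-1) + 3 / 2 * c * ln delta^-1 -> A w} ->
  ((1 - delta)%:E <= mu A)%E.
Proof.
move=> cv T0 /andP[d0 d1] mA SA; set l := ln delta^-1 in SA *.
set eps := 2 * _ + _ in SA.
have l0 : 0 < l by rewrite ln_gt0// invf_gt1.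
suff h : E (fun w => \1_(~` A) w) <= delta.
  have mAC : measurable (~` A) by exact: measurableC.
  rewrite Exp_indicator// in h.
  have -> : mu A = (1 - (fine (mu (~` A)))%:E)%E.
    rewrite fineK ?fin_num_measure// probability_setC// oppeB ?fin_num_measure//.
    by rewrite addeA subee// add0e.
  by rewrite -EFinB lee_fin lerB.
have mA' : measurable_fun setT (\1_(~` A) : Omega -> R).
  by apply/measurable_indic/measurableC.
have L1A : L1 mu (\1_(~` A)).
  apply: (L1_bounded (c := 1)) => //.
  by apply: aeW => w; rewrite indicE; case: (_ \in _); rewrite ?normr1 ?normr0.
(* If [c = 0], the sum vanishes almost surely and no [theta] has to be chosen. *)
have [c0|c0] := leP c 0.
  rewrite (le_trans _ (ltW d0))// -[leRHS](Exp_cst mu 0); apply: Exp_le => //.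
    exact: L1_cst.
  apply: filterS2 (S_bound T) SA => w h1 h2; rewrite indicE memNset// => h3; apply: h3.
  apply: h2; have c00 : c = 0 by apply/le_anti; rewrite c0 c_ge0.
  rewrite /eps c00 !(mulr0, mul0r) addr0 (le_trans (ler_norm _))// (le_trans h1)// c00 mulr0.
  by rewrite mulr_ge0 ?sqrtr_ge0.
have v0 := cv c0; have T0' : 0 < T%:R :> R by rewrite ltr0n.
have [theta [th0 thc the]] : exists theta, [/\ 0 <= theta, theta * c <= 2 / 3 &
    T%:R * (theta ^+ 2 * v) - theta * eps <= - l].
  pose q := Num.sqrt (T%:R * v * l); pose s := Num.sqrt l; pose r := Num.sqrt (T%:R * v).
  have Tv : 0 < T%:R * v by rewrite mulr_gt0.
  have r0 : 0 < r by rewrite sqrtr_gt0.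
  have s0 : 0 < s by rewrite sqrtr_gt0.
  have qE : q = r * s by rewrite /q sqrtrM// ltW.
  have s2 : s ^+ 2 = l by rewrite sqr_sqrtr// ltW.
  have r2 : r ^+ 2 = T%:R * v by rewrite sqr_sqrtr// ltW.
  have epsE : eps = 2 * (r * s) + 3 / 2 * c * s ^+ 2 by rewrite s2 -qE.
  (* The balanced choice [theta = s / r] is taken if it respects [theta * c <= 2 / 3]; otherwise the
     largest admissible [theta = 2 / (3 * c)], for which the term of [eps] linear in [c] alone gives
     [s ^+ 2]. *)
  have [sc|cs] := leP (s * c) (2 / 3 * r).
    exists (s / r); split.
    - by rewrite divr_ge0// ltW.
    - by rewrite mulrAC ler_pdivrMr.
    rewrite (_ : T%:R * _ = s ^+ 2); last first.
      by rewrite mulrCA -r2; field; rewrite gt_eqF.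
    have -> : s / r * eps = 2 * s ^+ 2 + 3 / 2 * c * s ^+ 2 * (s / r).
      by rewrite epsE; field; rewrite gt_eqF.
    have : 0 <= 3 / 2 * c * s ^+ 2 * (s / r).
      by rewrite !mulr_ge0 ?invr_ge0 ?sqr_ge0// ltW.
    rewrite -s2; lra.
  exists (2 / (3 * c)); split.
  - by rewrite divr_ge0// mulr_ge0// ltW.
  - by rewrite le_eqVlt; apply/orP; left; apply/eqP; field; rewrite gt_eqF.
  rewrite mulrCA -r2 epsE -s2.
  have u0 : 0 <= 2 / (3 * c) * r by rewrite mulr_ge0 ?divr_ge0 ?mulr_ge0// ltW.
  have us : 2 / (3 * c) * r <= s.
    by rewrite mulrAC ler_pdivrMr ?mulr_gt0//; lra.
  have -> : (2 / (3 * c)) ^+ 2 * r ^+ 2 = (2 / (3 * c) * r) ^+ 2 by rewrite -exprMn.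
  have -> : 2 / (3 * c) * (2 * (r * s) + 3 / 2 * c * s ^+ 2) =
      2 * (2 / (3 * c) * r) * s + s ^+ 2 by field; rewrite gt_eqF.
  move: u0 us; move: (2 / _ * r) => u; nra.
have [L1e Ee] := martingale_mgf T th0 thc.
have h1 : E (fun w => \1_(~` A) w) <= E (fun w => expR (- (theta * eps)) * expR (theta * S T w)).
  apply: Exp_le => //; first exact: L1Z.
  apply: filterS SA => w h; rewrite -expRD indicE.
  have [Aw|Aw] := pselect (A w); first by rewrite memNset ?expR_ge0.
  rewrite mem_set// -[leLHS]expR0 ler_expR addrC -mulrBr mulr_ge0// subr_ge0 leNgt.
  by apply/negP => /ltW /h.
apply: (le_trans h1); rewrite ExpZ//.
apply: (le_trans (ler_wpM2l (expR_ge0 _) Ee)).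
rewrite -expRD addrC (le_trans (y := expR (- l))) ?ler_expR//.
by rewrite expRN lnK ?posrE ?invr_gt0// invrK.
Qed.

End bernstein.

(** * Square-integrable variables and bounds in mean *)

Section square_integrable.
Context {R : realType} {dO : measure_display} {Omega : measurableType dO}.
Context (mu : probability Omega R).
Implicit Types X Y : Omega -> R.
Local Notation E X := (\int[mu]_w X w).

Definition L2 X := measurable_fun setT X /\ L1 mu (fun w => X w ^+ 2).

Lemma L2_dominated X Y : measurable_fun setT X -> L2 Y ->
  {ae mu, forall w, `|X w| <= Y w} -> L2 X.
Proof.
move=> mX [mY L1Y] XY; split=> //; apply: (L1_dominated _ L1Y).
  exact: measurable_funX.
by apply: filterS XY => w h; rewrite normrX lerXn2r// nnegrE// (le_trans _ h).
Qed.

Lemma L2_cst (c : R) : L2 (fun=> c).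
Proof. by split; [exact: measurable_cst|exact: L1_cst]. Qed.

Lemma L2D X Y : L2 X -> L2 Y -> L2 (fun w => X w + Y w).
Proof.
move=> [mX h1] [mY h2]; split; first exact: measurable_funD.
apply: (L1_dominated _ (L1Z 2 (L1D h1 h2))).
  by apply: measurable_funX; exact: measurable_funD.
apply: aeW => w; rewrite ger0_norm ?sqr_ge0//.
by have := sqr_ge0 (X w - Y w); lra.
Qed.

Lemma L2Z (c : R) X : L2 X -> L2 (fun w => c * X w).
Proof.
move=> [mX h1]; split; first exact: measurable_funM.
by under [X in L1 _ X]eq_fun do rewrite exprMn; exact: L1Z.
Qed.

Lemma L2B X Y : L2 X -> L2 Y -> L2 (fun w => X w - Y w).
Proof.
move=> h1 h2; have := L2D h1 (L2Z (-1) h2).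
by under [X in L2 X]eq_fun do rewrite mulN1r.
Qed.

Lemma L2_sum I (s : seq I) (F : I -> Omega -> R) :
  (forall i, L2 (F i)) -> L2 (fun w => \sum_(i <- s) F i w).
Proof.
move=> h; elim: s => [|i s IH].
  by under [X in L2 X]eq_fun do rewrite big_nil; exact: L2_cst.
by under [X in L2 X]eq_fun do rewrite big_cons; exact: L2D.
Qed.

Lemma L2M X Y : L2 X -> L2 Y -> L1 mu (fun w => X w * Y w).
Proof.
move=> [mX h1] [mY h2]; apply: (L1_dominated _ (L1D h1 h2)).
  exact: measurable_funM.
apply: aeW => w; rewrite normrM -(real_normK (num_real (X w))) -(real_normK (num_real (Y w))).
have := sqr_ge0 (`|X w| - `|Y w|); have := sqr_ge0 `|X w|; have := sqr_ge0 `|Y w|.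
lra.
Qed.

Lemma L2_L1 X : L2 X -> L1 mu X.
Proof.
by move=> /(L2M (L2_cst 1)); under [X in L1 _ X]eq_fun do rewrite mul1r.
Qed.

(** Measurability of [X] is recovered from that of its square. Used for the dual norm of a
    stochastic gradient, about which the moment hypothesis only gives the square. *)
Lemma L2_sqrt X : (forall w, 0 <= X w) -> L1 mu (fun w => X w ^+ 2) -> L2 X.
Proof.
move=> X0 h; split=> //.
have -> : X = (fun w => Num.sqrt (X w ^+ 2)).
  by apply/funext => w; rewrite sqrtr_sqr ger0_norm.
have ms : measurable_fun setT (@Num.sqrt R).
  by apply: continuous_measurable_fun; exact: sqrt_continuous.
exact: measurableT_comp ms (L1_measurable h).
Qed.

End square_integrable.

Section mean_bound.
Context {R : realType} {dO : measure_display} {Omega : measurableType dO}.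
Context (mu : probability Omega R).
Implicit Types X Y : Omega -> R.
Local Notation E X := (\int[mu]_w X w).

(** Integrability travels with the bound, so both propagate together through the nested sums of
    [network_bound]. *)
Definition mean_le X (c : R) := L1 mu X /\ E X <= c.

Lemma mean_le_cst c : mean_le (fun=> c) c.
Proof. by split; [exact: L1_cst|rewrite Exp_cst]. Qed.

Lemma mean_leD X Y a b : mean_le X a -> mean_le Y b ->
  mean_le (fun w => X w + Y w) (a + b).
Proof. by move=> [h1 h2] [h3 h4]; split; [exact: L1D|rewrite ExpD// lerD]. Qed.

Lemma mean_leZ k X a : 0 <= k -> mean_le X a -> mean_le (fun w => k * X w) (k * a).
Proof. by move=> k0 [h1 h2]; split; [exact: L1Z|rewrite ExpZ// ler_wpM2l]. Qed.

Lemma mean_le_sum I (s : seq I) (F : I -> Omega -> R) (a : I -> R) :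
  (forall i, mean_le (F i) (a i)) ->
  mean_le (fun w => \sum_(i <- s) F i w) (\sum_(i <- s) a i).
Proof.
move=> h; split; first by apply: L1_sum => i; case: (h i).
by rewrite Exp_sum; [apply: ler_sum => i _; case: (h i)|move=> i; case: (h i)].
Qed.

(** [network_bound] is affine in [q] with nonnegative coefficients, so second moments are enough: no
    joint law of gradients at different nodes or times enters. *)
Lemma mean_le_network n (P : 'M[R]_n) T (a : nat -> R) i (L : R)
    (q : 'I_n -> nat -> Omega -> R) : (forall t, 0 <= a t) ->
  (forall j t, mean_le (q j t) (L ^+ 2)) ->
  mean_le (fun w => network_bound P T a i L (fun j t => q j t w))
    (network_bound P T a i L (fun _ _ => L ^+ 2)).
Proof.
move=> a0 hq; have half X c : mean_le X c -> mean_le (fun w => X w / 2) (c / 2).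
  move=> /(mean_leZ (k := 2^-1)); rewrite invr_ge0 => /(_ (ler0n _ 2)).
  by under [X in mean_le X]eq_fun do rewrite mulrC; rewrite mulrC.
apply: mean_le_sum => t; apply: mean_le_sum => j.
apply: mean_leD; first apply: mean_leD.
- by apply: mean_leZ => //; rewrite divr_ge0.
- apply: mean_leZ => //; apply: mean_le_sum => s; apply: mean_le_sum => l.
  by apply: mean_leZ; [exact: normr_ge0|apply: half; exact: mean_leD].
- apply: mean_leZ => //; apply: mean_le_sum => s; apply: mean_le_sum => l.
  apply: mean_leZ; [exact: normr_ge0|apply: half; apply: mean_leD => //].
  exact: mean_le_cst.
Qed.

End mean_bound.

Lemma network_bound_le (R : realType) n (P : 'M[R]_n) T (a : nat -> R) i (L : R)
    (q q' : 'I_n -> nat -> R) : (forall t, 0 <= a t) ->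
  (forall j t, q j t <= q' j t) ->
  network_bound P T a i L q <= network_bound P T a i L q'.
Proof.
move=> a0 qq; apply: ler_sum => t _; apply: ler_sum => j _.
apply: lerD; first apply: lerD.
- by rewrite ler_wpM2l// divr_ge0.
- rewrite ler_wpM2l//; apply: ler_sum => s _; apply: ler_sum => l _.
  by apply: ler_wpM2l; [exact: normr_ge0|rewrite ler_pM2r// lerD].
- rewrite ler_wpM2l//; apply: ler_sum => s _; apply: ler_sum => l _.
  by apply: ler_wpM2l; [exact: normr_ge0|rewrite ler_pM2r// lerD].
Qed.

Section almost_everywhere.
Context {R : realType} {dO : measure_display} {Omega : measurableType dO}.
Context (mu : probability Omega R).

(** Serves to read a deterministic fact, the sign of [L], off an almost sure hypothesis. *)
Lemma ae_witness (Q : Omega -> Prop) : {ae mu, forall w, Q w} -> exists w, Q w.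
Proof.
move=> [A [mA A0 QA]]; apply: contrapT => /forallNP nQ.
have AT : A = setT by apply/seteqP; split=> // w _; apply: QA => /= /nQ.
by move: A0; rewrite AT probability_setT => /eqP; rewrite onee_eq0.
Qed.

End almost_everywhere.

(** * Stochastic dual averaging *)

Section stochastic_dual_averaging.
Context {R : realType} {n d : nat} (n_gt1 : (2 <= n)%N).
Context (f : 'I_n -> 'rV[R]_d -> R).
Hypothesis (f_convex : forall i, convex_function setT (f i)).
Context (X : set 'rV[R]_d).
Hypotheses (X_convex : convex_set X) (X0 : X 0).
Context (nrm : 'rV[R]_d -> R) (L : R).
Hypothesis (nrm_norm : is_norm nrm).
Hypothesis (f_lipschitz :
  forall i x y, X x -> X y -> `|f i x - f i y| <= L * nrm (x - y)).
Hypothesis (f_subgradient : forall i x g,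
  X x -> subdifferential (f i) x g -> dual_norm nrm g <= L).
Context (psi : 'rV[R]_d -> R).
Hypotheses (psi_strong : strongly_convex1 nrm X psi).
Hypotheses (psi_ge0 : forall x, X x -> 0 <= psi x) (psi0 : psi 0 = 0).
Context (P : 'M[R]_n).
Hypotheses (P_stoch : doubly_stochastic P) (P_gap : sigma2 P < 1).
Context (alpha : nat -> R).
Hypotheses (alpha_gt0 : forall t, 0 < alpha t) (alpha_noninc : nonincreasing_seq alpha).
Context {dO : measure_display} {Omega : measurableType dO} (mu : probability Omega R).
Context (F : nat -> set (set Omega)).
Hypothesis (F_filtration : filtration F).
Context (ghat g z x : 'I_n -> nat -> Omega -> 'rV[R]_d).
Hypothesis (x_gen : dual_averaging X psi P alpha ghat z x).
Hypothesis (x_adapted : adapted F ghat x).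
Hypothesis (g_cond_exp : forall i t, (1 <= t)%N ->
  is_vec_cond_exp mu (F t.-1) (ghat i t) (g i t)).
Hypothesis (g_subgradient : forall i t, (1 <= t)%N ->
  {ae mu, forall w, subdifferential (f i) (x i t w) (g i t w)}).
Hypothesis (ghat_moment : forall i t, (1 <= t)%N ->
  cond_exp_le mu (F t.-1) (fun w => dual_norm nrm (ghat i t w) ^+ 2) (L ^+ 2)).
Context (xs : 'rV[R]_d).
Hypothesis (xs_X : X xs).
Local Notation E Y := (\int[mu]_w Y w).
Local Notation D := (dual_norm nrm).

Let F_sigma t : sigma_algebra setT (F t). Proof. by case: F_filtration. Qed.
Let F_meas t : F t `<=` measurable. Proof. by case: F_filtration. Qed.
Let n_gt0 : 0 < n%:R :> R. Proof. by rewrite ltr0n ltnW. Qed.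

(** Indices are shifted: index [t] stands for time [t + 1], whose iterate is computed with
    [alpha t]. *)
Let G w t : 'M[R]_(n, d) := \matrix_(j, k) ghat j t.+1 w 0 k.
Let Z w t : 'M[R]_(n, d) := \matrix_(j, k) z j t.+1 w 0 k.

Let row_G w t j : row j (G w t) = ghat j t.+1 w.
Proof. by apply/rowP => k; rewrite !mxE. Qed.

Let row_Z w t j : row j (Z w t) = z j t.+1 w.
Proof. by apply/rowP => k; rewrite !mxE. Qed.

Let Z0 w : Z w 0%N = 0.
Proof. by case: x_gen => z1 _ _ _; apply/matrixP => j k; rewrite !mxE z1 mxE. Qed.

Let ZS w t : Z w t.+1 = P *m Z w t + G w t.
Proof.
case: x_gen => _ _ zS _; apply/matrixP => j k; rewrite !mxE zS// !mxE summxE.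
by congr (_ + _); apply: eq_bigr => l _; rewrite !mxE.
Qed.

Let x_prox w j t : prox X psi (row j (Z w t)) (alpha t) (x j t.+1 w).
Proof.
case: x_gen => z1 x1 zS xS; case: t => [|t]; first by rewrite Z0 row0.
by rewrite row_Z; exact: xS.
Qed.

Let x_X w j t : X (x j t.+1 w). Proof. by case: (x_prox w j t). Qed.

Let alphaS t : alpha t.+1 <= alpha t.
Proof. exact: alpha_noninc (leqnSn t). Qed.

(** If [X] is a single point, the Lipschitz inequality says nothing about [L]; its sign comes from
    the norm bound on an actual subgradient. *)
Lemma lipschitz_const_ge0 : 0 <= L.
Proof.
have [w gw] := ae_witness (g_subgradient (Ordinal (ltnW n_gt1)) (leqnn 1)).
exact: le_trans (dual_norm_ge0 nrm_norm _) (f_subgradient (x_X w _ 0) gw).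
Qed.

Lemma objective_lipschitz y y' : X y -> X y' ->
  `|objective f y - objective f y'| <= L * nrm (y - y').
Proof.
move=> Xy Xy'; rewrite -mulrBr -sumrB normrM ger0_norm ?invr_ge0 ?(ltW n_gt0)//.
rewrite ler_pdivrMl// (le_trans (ler_norm_sum _ _ _))//.
rewrite (le_trans (ler_sum _ (fun i _ => f_lipschitz i Xy Xy')))//.
by rewrite sumr_const card_ord mulr_natl.
Qed.

Lemma running_averageE i T w :
  running_average x i T w = T%:R^-1 *: \sum_(t < T) x i t.+1 w.
Proof. by rewrite /running_average big_add1 big_mkord. Qed.

Lemma running_average_X i T w : (0 < T)%N -> X (running_average x i T w).
Proof.
move=> T0; rewrite running_averageE.
by apply: (convex_set_mean (x := fun t => x i t.+1 w)).
Qed.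

Let x_measF j t k : measurable_wrt (F t) (fun w => x j t.+1 w 0 k).
Proof. by case: x_adapted => _ h; apply: h; rewrite /= leqnn. Qed.

Let x_meas j t k : measurable_fun setT (fun w => x j t.+1 w 0 k).
Proof. exact: measurable_wrt_measurable (x_measF j t k). Qed.

Lemma measurable_objective i T : (0 < T)%N ->
  measurable_fun setT (fun w => objective f (running_average x i T w)).
Proof.
move=> T0; apply: (measurable_lipschitz_comp nrm_norm objective_lipschitz).
  by move=> w; exact: running_average_X.
move=> k; rewrite (_ : (fun w => _) = (fun w => T%:R^-1 * \sum_(t < T) x i t.+1 w 0 k)).
  by apply: measurable_funM => //; apply: measurable_sum.
by apply/funext => w; rewrite running_averageE mxE summxE.
Qed.

Let noise t j w : R := dotp (g j t.+1 w - ghat j t.+1 w) (x j t.+1 w - xs).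
(** A martingale difference despite its name: measurable for [F t.+1], with conditional mean zero
    given [F t]. *)
Let drift t w : R := n%:R^-1 * \sum_j noise t j w.

Lemma stochastic_bound i T : (0 < T)%N -> {ae mu, forall w,
  objective f (running_average x i T w) - objective f xs <=
  T%:R^-1 * ((alpha T)^-1 * psi xs + n%:R^-1 *
     network_bound P T alpha i L (fun j t => D (ghat j t.+1 w) ^+ 2)
   + \sum_(t < T) drift t w)}.
Proof.
move=> T0; have h : {ae mu, forall w, forall t, forall j,
    subdifferential (f j) (x j t.+1 w) (g j t.+1 w)}.
  by apply/ae_foralln => t; apply: filter_forall => j; exact: g_subgradient.
apply: filterS h => w h; rewrite running_averageE.
have := @pathwise_bound _ _ P T alpha i L P_stoch T0 n_gt1 alpha_gt0 alphaS d
  nrm X psi nrm_norm X_convex X0 psi_strong psi_ge0 f f_convex f_lipschitz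
  lipschitz_const_ge0 (fun j t => x j t.+1 w) (fun j t => g j t.+1 w) (G w) (Z w)
  (x_prox w) (Z0 w) (ZS w) (fun j t _ => h t j) xs xs_X.
have -> : (fun j t => D (row j (G w t)) ^+ 2) = (fun j t => D (ghat j t.+1 w) ^+ 2).
  by apply/funext => j; apply/funext => t; rewrite row_G.
have -> : \sum_(t < T) drift t w = n%:R^-1 * \sum_(t < T) \sum_j
    dotp (g j t.+1 w - row j (G w t)) (x j t.+1 w - xs).
  rewrite mulr_sumr; apply: eq_bigr => t _; congr (_ * _).
  by apply: eq_bigr => j _; rewrite row_G.
exact.
Qed.

Lemma stochastic_base_bound T i : (0 < T)%N ->
  T%:R^-1 * ((alpha T)^-1 * psi xs + n%:R^-1 *
     network_bound P T alpha i L (fun _ _ => L ^+ 2)) <=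
  base_bound n L (sigma2 P) alpha (psi xs) T.
Proof.
move=> T0; apply: (le_trans _ (base_bound_ge L (psi xs) T0 n_gt1 P_gap alpha_gt0)).
rewrite ler_wpM2l ?invr_ge0// lerD2l ler_wpM2l ?invr_ge0 ?(ltW n_gt0)//.
by apply: network_bound_cst => // t; exact: ltW.
Qed.

Let ghat_L1 j t k : L1 mu (fun w => ghat j t.+1 w 0 k).
Proof. by case: (g_cond_exp j (ltn0Sn t) k). Qed.

Let g_L1 j t k : L1 mu (fun w => g j t.+1 w 0 k).
Proof. by case: (g_cond_exp j (ltn0Sn t) k). Qed.

Let g_measF j t k : measurable_wrt (F t) (fun w => g j t.+1 w 0 k).
Proof. by case: (g_cond_exp j (ltn0Sn t) k). Qed.

Let ghat_measF j t k : measurable_wrt (F t.+1) (fun w => ghat j t.+1 w 0 k).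
Proof. by case: x_adapted => h _; apply: h; rewrite /= leqnn. Qed.

Let g_bound j t : {ae mu, forall w, D (g j t.+1 w) <= L}.
Proof.
by apply: filterS (g_subgradient j (ltn0Sn t)) => w; apply: f_subgradient.
Qed.

Let drift_meas t : measurable_wrt (F t.+1) (drift t).
Proof.
have FS : F t `<=` F t.+1 by case: F_filtration => _ _; apply.
have up (Y : Omega -> R) : measurable_wrt (F t) Y -> measurable_wrt (F t.+1) Y.
  by move=> mY B mB; exact/FS/mY.
apply: measurable_wrtM => //; first exact: measurable_wrt_cst.
apply: measurable_wrt_sum => // j; apply: measurable_wrt_sum => // k.
have -> : (fun w => (g j t.+1 w - ghat j t.+1 w) 0 k * (x j t.+1 w - xs) 0 k) =
    (fun w => (g j t.+1 w 0 k - ghat j t.+1 w 0 k) * (x j t.+1 w 0 k - xs 0 k)).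
  by apply/funext => w; rewrite !mxE.
apply: measurable_wrtM => //.
  apply: measurable_wrtB => //; exact: up.
apply: measurable_wrtB => //; first exact: up.
exact: measurable_wrt_cst.
Qed.

(** The weight [Y] is 1 for the expectation and an exponential for the tail bounds. Integrability is
    left to the caller: it rests on second moments in the first case and on boundedness in the
    second. *)
Let drift_mean t (Y : Omega -> R) : measurable_wrt (F t) Y ->
  (forall j k, L1 mu (fun w => (ghat j t.+1 w 0 k - g j t.+1 w 0 k) *
     (Y w * (x j t.+1 w 0 k - xs 0 k)))) ->
  E (fun w => Y w * drift t w) = 0.
Proof.
move=> mY h.
transitivity (E (fun w => (- n%:R^-1) * \sum_j \sum_k
    (ghat j t.+1 w 0 k - g j t.+1 w 0 k) * (Y w * (x j t.+1 w 0 k - xs 0 k)))).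
  apply: eq_Rintegral => w _; rewrite /drift mulrCA mulNr -mulrN; congr (_ * _).
  rewrite -sumrN mulr_sumr; apply: eq_bigr => j _; rewrite -sumrN mulr_sumr.
  by apply: eq_bigr => k _; rewrite !mxE; ring.
rewrite ExpZ; last by apply: L1_sum => j; exact: L1_sum.
rewrite Exp_sum; last by move=> j; exact: L1_sum.
rewrite big1 ?mulr0// => j _; rewrite Exp_sum// big1// => k _.
apply: (Exp_cond_exp_pull_out (F_sigma t) (F_meas (t := t)) (g_cond_exp j (ltn0Sn t) k)) => //.
apply: measurable_wrtM => //; apply: measurable_wrtB => //.
exact: measurable_wrt_cst.
Qed.

(** * The bound in expectation *)

Section expectation_bound.

Let dual_ghat_mean j t :
  L1 mu (fun w => D (ghat j t.+1 w) ^+ 2) /\ E (fun w => D (ghat j t.+1 w) ^+ 2) <= L ^+ 2.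
Proof. by apply: (Exp_le_cond_exp (F_sigma t)); exact: (ghat_moment j (ltn0Sn t)). Qed.

Let dual_ghat_L2 j t : L2 mu (fun w => D (ghat j t.+1 w)).
Proof.
apply: L2_sqrt; first by move=> w; exact: dual_norm_ge0.
by case: (dual_ghat_mean j t).
Qed.

Let noise_coef_L2 j t k : L2 mu (fun w => ghat j t.+1 w 0 k - g j t.+1 w 0 k).
Proof.
have [C C0 hC] := dual_norm_coord nrm_norm; apply: L2B.
  apply: (L2_dominated _ (L2Z C (dual_ghat_L2 j t))).
    exact: L1_measurable (ghat_L1 j t k).
  by apply: aeW.
apply: (L2_dominated _ (L2_cst mu (C * L))).
  exact: L1_measurable (g_L1 j t k).
by apply: filterS (g_bound j t) => w h; rewrite (le_trans (hC _ _))// ler_wpM2l.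
Qed.

(** [X] may be unbounded; the iterate is dominated by a fixed linear combination of dual norms of
    past gradients, each square-integrable. *)
Let x_L2 j t k : L2 mu (fun w => x j t.+1 w 0 k - xs 0 k).
Proof.
apply: L2B; last exact: L2_cst.
have [C C0 hC] := is_norm_coord nrm_norm.
have L2sum := L2_sum (index_enum _) (fun s : 'I_t => L2_sum (index_enum _)
  (fun l : 'I_n => L2Z `|(P ^+ (t.-1 - s)) j l| (dual_ghat_L2 l s))).
apply: (L2_dominated (x_meas j t k) (L2Z C (L2Z (2 * alpha t) L2sum))).
apply: aeW => w; rewrite (le_trans (hC _ _))// ler_wpM2l//.
have := @prox_norm_bound _ _ _ nrm X psi nrm_norm X_convex X0 psi_strong psi_ge0
  alpha (fun j t => x j t.+1 w) (G w) (Z w) alpha_gt0 (x_prox w) (Z0 w) P (ZS w) j t psi0.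
by under eq_bigr do under eq_bigr do rewrite row_G.
Qed.

Lemma expectation_bound (i : 'I_n) (T : nat) : (1 <= T)%N ->
  ('E_mu[fun w => objective f (running_average x i T w)] - (objective f xs)%:E
     <= (base_bound n L (sigma2 P) alpha (psi xs) T)%:E)%E.
Proof.
move=> T0; set Y := fun w => _; have mY : measurable_fun setT Y by exact: measurable_objective.
have driftL1 t : L1 mu (drift t).
  apply: L1Z; apply: L1_sum => j; apply: L1_sum => k.
  have := L1N (L2M (noise_coef_L2 j t k) (x_L2 j t k)).
  congr L1; apply/funext => w; rewrite !mxE; ring.
have drift0 t : E (drift t) = 0.
  have := @drift_mean t (fun=> 1) (measurable_wrt_cst (F_sigma t) _).
  under eq_Rintegral do rewrite mul1r; apply => j k.
  under [X in L1 _ X]eq_fun do rewrite mul1r.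
  exact: L2M.
have [netL1 netE] := mean_le_network P T i (fun t => ltW (alpha_gt0 t)) dual_ghat_mean.
pose B w := objective f xs + T%:R^-1 * ((alpha T)^-1 * psi xs + n%:R^-1 *
     network_bound P T alpha i L (fun j t => D (ghat j t.+1 w) ^+ 2)
   + \sum_(t < T) drift t w).
have inL1 : L1 mu (fun w => (alpha T)^-1 * psi xs + n%:R^-1 *
     network_bound P T alpha i L (fun j t => D (ghat j t.+1 w) ^+ 2)).
  by apply: L1D; [exact: L1_cst|exact: L1Z].
have BL1 : L1 mu B.
  apply: L1D; first exact: L1_cst.
  by apply: L1Z; apply: L1D => //; exact: L1_sum.
have YB : {ae mu, forall w, Y w <= B w}.
  by apply: filterS (stochastic_bound i T0) => w; rewrite lerBlDl.
(* [YB] bounds [Y] from one side only; integrability comes from the Lipschitz bound around [xs] and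
   the coordinates of the running average. *)
have YL1 : L1 mu Y.
  have xL1 k : L1 mu (fun w => `|running_average x i T w 0 k - xs 0 k|).
    apply: L1_norm; apply: L1B; last exact: L1_cst.
    have := L1Z T%:R^-1 (L1_sum (index_enum _) (fun t : 'I_T =>
      L1D (L2_L1 (x_L2 i t k)) (L1_cst mu (xs 0 k)))).
    congr L1; apply/funext => w; rewrite running_averageE mxE summxE; congr (_ * _).
    by apply: eq_bigr => t _; rewrite subrK.
  apply: (L1_dominated mY (L1D (L1_cst mu `|objective f xs|) (L1Z L (L1_sum
    (index_enum _) (fun k => L1Z (nrm (delta_mx 0 k)) (xL1 k)))))).
  apply: aeW => w; rewrite -[Y w](subrK (objective f xs)) addrC (le_trans (ler_normD _ _))//.
  rewrite lerD2l (le_trans (objective_lipschitz (running_average_X i w T0) xs_X))//.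
  rewrite ler_wpM2l ?lipschitz_const_ge0// {1}(row_sum_delta (_ - _)).
  rewrite (le_trans (is_norm_sum nrm_norm _ _))//; apply: ler_sum => k _.
  by rewrite (is_normZ nrm_norm) mulrC !mxE.
rewrite unlock Exp_fin// -EFinB lee_fin lerBlDl.
apply: (le_trans (Exp_le YL1 BL1 YB)); rewrite /B ExpD; last 2 first.
- exact: L1_cst.
- by apply: L1Z; apply: L1D => //; exact: L1_sum.
rewrite Exp_cst lerD2l ExpZ; last by apply: L1D => //; exact: L1_sum.
rewrite ExpD//; last exact: L1_sum.
rewrite Exp_sum// [X in _ + X]big1 ?addr0//.
rewrite ExpD; [|exact: L1_cst|exact: L1Z].
rewrite Exp_cst ExpZ// (le_trans _ (stochastic_base_bound i T0))//.
by rewrite ler_wpM2l ?invr_ge0// lerD2l ler_wpM2l ?invr_ge0// ltW.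
Qed.

End expectation_bound.

(** * The bounds with high probability *)

Section high_probability_bound.

Hypothesis (X_bounded : has_ubound [set nrm (y - xs) | y in X]).
Hypothesis (ghat_bound : forall i t, (1 <= t)%N ->
  {ae mu, forall w, D (ghat i t w) <= L}).
Local Notation r := (radius_about nrm X xs).
(** The almost sure bound on one noise term, hence on their mean: a difference of two vectors of
    dual norm at most [L], times the radius. *)
Let c : R := 2 * L * r.

Let nrm_le_radius y : X y -> nrm (y - xs) <= r.
Proof. by move=> Xy; apply: ub_le_sup => //; exists y. Qed.

Lemma radius_ge0 : 0 <= r.
Proof. by have := nrm_le_radius xs_X; rewrite subrr is_norm0. Qed.

Let c_ge0 : 0 <= c.
Proof. by rewrite mulr_ge0 ?radius_ge0// mulr_ge0// lipschitz_const_ge0. Qed.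

Let noise_bound t j : {ae mu, forall w, `|noise t j w| <= c}.
Proof.
apply: filterS2 (g_bound j t) (ghat_bound j (ltn0Sn t)) => w h1 h2.
rewrite (le_trans (abs_dotp_le_dual nrm_norm _ _))// /c.
apply: ler_pM; [exact: dual_norm_ge0|exact: is_norm_ge0| |exact: nrm_le_radius].
rewrite (le_trans (dual_normD nrm_norm _ _))// mulr_natl mulr2n lerD//.
rewrite -scaleN1r (le_trans (dual_normZ_le nrm_norm _ _))//.
by rewrite normrN1 mul1r.
Qed.

Let drift_bound t : {ae mu, forall w, `|drift t w| <= c}.
Proof.
have : {ae mu, forall w, forall j, `|noise t j w| <= c}.
  by apply: filter_forall => j; exact: noise_bound.
apply: filterS => w h; rewrite normrM ger0_norm ?invr_ge0 ?(ltW n_gt0)//.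
rewrite ler_pdivrMl// (le_trans (ler_norm_sum _ _ _))//.
by rewrite (le_trans (ler_sum _ (fun j _ => h j)))// sumr_const card_ord mulr_natl.
Qed.

Let noise_coef_bounded : exists2 K, 0 <= K & forall j t k,
  {ae mu, forall w, `|ghat j t.+1 w 0 k - g j t.+1 w 0 k| <= K}.
Proof.
have [C C0 hC] := dual_norm_coord nrm_norm.
exists (C * L + C * L); first by rewrite addr_ge0// mulr_ge0// lipschitz_const_ge0.
move=> j t k; apply: filterS2 (g_bound j t) (ghat_bound j (ltn0Sn t)) => w h1 h2.
rewrite (le_trans (ler_normB _ _))// lerD// (le_trans (hC _ _))//;
  by rewrite ler_wpM2l.
Qed.

Let x_bounded : exists2 K, 0 <= K & forall j t k w,
  `|x j t.+1 w 0 k - xs 0 k| <= K.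
Proof.
have [C C0 hC] := is_norm_coord nrm_norm.
exists (C * r); first by rewrite mulr_ge0// radius_ge0.
move=> j t k w; have := hC (x j t.+1 w - xs) k; rewrite !mxE => /le_trans; apply.
by rewrite ler_wpM2l// nrm_le_radius.
Qed.

Let noise_coef_meas j t k :
  measurable_fun setT (fun w => ghat j t.+1 w 0 k - g j t.+1 w 0 k).
Proof. exact: L1_measurable (L1B (ghat_L1 j t k) (g_L1 j t k)). Qed.

Let x_coef_meas j t k : measurable_fun setT (fun w => x j t.+1 w 0 k - xs 0 k).
Proof. by apply: measurable_funB. Qed.

Section weights.
Context (t : nat) (Y : Omega -> R) (M : R).
Hypotheses (Y_meas : measurable_wrt (F t) Y) (Y_ge0 : forall w, 0 <= Y w).
Hypothesis (Y_le : {ae mu, forall w, Y w <= M}).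

Let mY : measurable_fun setT Y. Proof. exact: measurable_wrt_measurable Y_meas. Qed.

Let noise_meas j : measurable_fun setT (noise t j).
Proof.
apply: measurable_sum => k.
have -> : (fun w => (g j t.+1 w - ghat j t.+1 w) 0 k * (x j t.+1 w - xs) 0 k) =
    (fun w => (-1 * (ghat j t.+1 w 0 k - g j t.+1 w 0 k)) * (x j t.+1 w 0 k - xs 0 k)).
  by apply/funext => w; rewrite !mxE mulN1r opprB.
by apply: measurable_funM => //; exact: measurable_funM.
Qed.

Lemma weight_L1 : L1 mu Y.
Proof.
by apply: (L1_bounded mY (c := M)); apply: filterS Y_le => w h; rewrite ger0_norm.
Qed.

Lemma weighted_L1 (V : Omega -> R) K : measurable_fun setT V ->
  {ae mu, forall w, `|V w| <= K} -> L1 mu (fun w => Y w * V w).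
Proof.
move=> mV VK; apply: (L1_bounded (c := M * K)); first exact: measurable_funM.
apply: filterS2 Y_le VK => w h1 h2; rewrite normrM ler_pM//.
by rewrite ger0_norm.
Qed.

Lemma weighted_drift_mean : E (fun w => Y w * drift t w) = 0.
Proof.
apply: drift_mean => // j k.
have [K1 K10 hK1] := noise_coef_bounded; have [K2 K20 hK2] := x_bounded.
have mV : measurable_fun setT (fun w => (ghat j t.+1 w 0 k - g j t.+1 w 0 k) *
    (x j t.+1 w 0 k - xs 0 k)) by exact: measurable_funM.
have VK : {ae mu, forall w, `|(ghat j t.+1 w 0 k - g j t.+1 w 0 k) *
    (x j t.+1 w 0 k - xs 0 k)| <= K1 * K2}.
  by apply: filterS (hK1 j t k) => w h; rewrite normrM ler_pM.
have := weighted_L1 mV VK.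
by congr L1; apply/funext => w; rewrite mulrCA.
Qed.

Lemma weighted_drift_var : E (fun w => Y w * drift t w ^+ 2) <= c ^+ 2 * E Y.
Proof.
have mdrift : measurable_fun setT (drift t).
  exact: measurable_wrt_measurable (F_meas (t := t.+1)) (drift_meas t).
rewrite -(ExpZ _ weight_L1); apply: Exp_le.
- apply: (@weighted_L1 (fun w => drift t w ^+ 2) (c ^+ 2)).
    exact: measurable_funX.
  by apply: filterS (drift_bound t) => w h; rewrite normrX lerXn2r// nnegrE.
- exact: L1Z weight_L1.
apply: filterS (drift_bound t) => w h; rewrite mulrC ler_wpM2r//.
by rewrite -(real_normK (num_real (drift t w))) lerXn2r// nnegrE.
Qed.

(** A mean of [n] uncorrelated terms: the cross terms vanish under any weight known at time [t],
    leaving [n] squares with the factor [n^-2]. *)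
Lemma weighted_drift_var_uncorrelated : uncorrelated mu F ghat g ->
  E (fun w => Y w * drift t w ^+ 2) <= c ^+ 2 / n%:R * E Y.
Proof.
move=> unc.
have [K1 K10 hK1] := noise_coef_bounded; have [K2 K20 hK2] := x_bounded.
have NN_L1 i j : L1 mu (fun w => Y w * (noise t i w * noise t j w)).
  apply: (@weighted_L1 _ (c * c)); first exact: measurable_funM.
  apply: filterS2 (noise_bound t i) (noise_bound t j) => w h1 h2.
  by rewrite normrM ler_pM.
have NN0 i j : i != j -> E (fun w => Y w * (noise t i w * noise t j w)) = 0.
  move=> ij.
  (* A product of two noise coordinates minus its conditional expectation, here the constant 0; the
     remaining factors are known given [F t]. *)
  pose V k l w := ((ghat i t.+1 w 0 k - g i t.+1 w 0 k) *
    (ghat j t.+1 w 0 l - g j t.+1 w 0 l) - 0) *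
    (Y w * ((x i t.+1 w 0 k - xs 0 k) * (x j t.+1 w 0 l - xs 0 l))).
  have V_L1 k l : L1 mu (V k l).
    pose U w := ((ghat i t.+1 w 0 k - g i t.+1 w 0 k) *
      (ghat j t.+1 w 0 l - g j t.+1 w 0 l)) *
      ((x i t.+1 w 0 k - xs 0 k) * (x j t.+1 w 0 l - xs 0 l)).
    have mU : measurable_fun setT U.
      by apply: measurable_funM; exact: measurable_funM.
    have UK : {ae mu, forall w, `|U w| <= (K1 * K1) * (K2 * K2)}.
      apply: filterS2 (hK1 i t k) (hK1 j t l) => w h1 h2.
      by rewrite !normrM; apply: ler_pM; rewrite ?mulr_ge0//; exact: ler_pM.
    have := weighted_L1 mU UK.
    by congr L1; apply/funext => w; rewrite /V subr0 /U mulrCA.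
  transitivity (E (fun w => \sum_k \sum_l V k l w)).
    apply: eq_Rintegral => w _; rewrite /noise /dotp big_distrlr mulr_sumr /=.
    apply: eq_bigr => k _; rewrite mulr_sumr; apply: eq_bigr => l _.
    by rewrite /V !mxE; ring.
  rewrite Exp_sum; last by move=> k; exact: L1_sum.
  rewrite big1// => k _; rewrite Exp_sum// big1// => l _.
  have := unc t.+1 i j (delta_mx 0 k) (delta_mx 0 l) (ltn0Sn t) ij.
  have -> : (fun w => dotp (ghat i t.+1 w - g i t.+1 w) (delta_mx 0 k) *
      dotp (ghat j t.+1 w - g j t.+1 w) (delta_mx 0 l)) =
    (fun w => (ghat i t.+1 w 0 k - g i t.+1 w 0 k) *
      (ghat j t.+1 w 0 l - g j t.+1 w 0 l)).
    by apply/funext => w; rewrite !dotp_delta !mxE.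
  move=> ce; apply: (Exp_cond_exp_pull_out (F_sigma t) (F_meas (t := t)) ce) => //;
    last exact: V_L1.
  apply: measurable_wrtM => //; apply: measurable_wrtM => //;
    by apply: measurable_wrtB => //; exact: measurable_wrt_cst.
apply: (@le_trans _ _ (E (fun w => n%:R^-1 ^+ 2 *
    \sum_i \sum_j Y w * (noise t i w * noise t j w)))).
  rewrite le_eqVlt; apply/orP; left; apply/eqP; apply: eq_Rintegral => w _.
  rewrite /drift exprMn mulrCA; congr (_ * _); rewrite expr2 big_distrlr mulr_sumr /=.
  by apply: eq_bigr => i _; rewrite mulr_sumr.
rewrite ExpZ; last by apply: L1_sum => i; exact: L1_sum.
rewrite Exp_sum; last by move=> i; exact: L1_sum.
apply: (@le_trans _ _ (n%:R^-1 ^+ 2 * \sum_(i < n) c ^+ 2 * E Y)).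
  rewrite ler_wpM2l ?sqr_ge0//; apply: ler_sum => i _; rewrite Exp_sum//.
  rewrite (bigD1 i)//= big1 ?addr0; last by move=> j ji; rewrite NN0 1?eq_sym.
  rewrite -(ExpZ _ weight_L1); apply: Exp_le => //; first exact: L1Z weight_L1.
  apply: filterS (noise_bound t i) => w h; rewrite mulrC ler_wpM2r// -expr2.
  by rewrite -(real_normK (num_real (noise t i w))) lerXn2r// nnegrE.
rewrite sumr_const card_ord -[_ *+ n]mulr_natl le_eqVlt; apply/orP; left; apply/eqP.
by field; rewrite gt_eqF.
Qed.

End weights.

(** Common to (2) and (3): [v] bounds the conditional variance and [B] is the noise term of the
    claim. The first alternative on [B] covers the trivial bound [c], the second is Bernstein's
    deviation divided by [T]. *)
Lemma high_probability (i : 'I_n) (T : nat) (delta v B : R) :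
  (1 <= T)%N -> 0 < delta < 1 -> 0 <= v -> (0 < c -> 0 < v) ->
  (forall t (Y : Omega -> R) M, measurable_wrt (F t) Y -> (forall w, 0 <= Y w) ->
     {ae mu, forall w, Y w <= M} -> E (fun w => Y w * drift t w ^+ 2) <= v * E Y) ->
  c <= B \/ T%:R^-1 * (2 * Num.sqrt (T%:R * v * ln delta^-1) + 3 / 2 * c * ln delta^-1) <= B ->
  ((1 - delta)%:E <= mu [set w |
     (objective f (running_average x i T w) - objective f xs <=
        base_bound n L (sigma2 P) alpha (psi xs) T + B)%R])%E.
Proof.
move=> T0 delta01 v0 cv var Bc; have T0' : 0 < T%:R :> R by rewrite ltr0n.
set A := [set w | _].
have mA : measurable A.
  have mf : measurable_fun setT (fun w => objective f (running_average x i T w) - objective f xs).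
    by apply: measurable_funB => //; exact: measurable_objective.
  have := mf measurableT _ (measurable_itv `]-oo, (base_bound n L (sigma2 P) alpha (psi xs) T + B)]).
  by rewrite setTI; congr measurable; apply/seteqP; split=> w /=; rewrite in_itv.
apply: (bernstein_tail F_filtration c_ge0 v0 drift_meas drift_bound _ var cv T0 delta01 mA).
  by move=> t Y M h1 h2 h3; exact: weighted_drift_mean h1 h2 h3.
have db : {ae mu, forall w t, `|drift t w| <= c} by apply/ae_foralln.
have qb : {ae mu, forall w, forall t, forall j, D (ghat j t.+1 w) <= L}.
  by apply/ae_foralln => t; apply: filter_forall => j; exact: ghat_bound.
apply: filterS3 (stochastic_bound i T0) db qb => w h1 h2 h3 h4; rewrite /A /=.
rewrite (le_trans h1)// mulrDr lerD//.
  rewrite (le_trans _ (stochastic_base_bound i T0))//.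
  rewrite ler_wpM2l ?invr_ge0// lerD2l ler_wpM2l ?invr_ge0 ?(ltW n_gt0)//.
  apply: network_bound_le => [t|j t]; first exact: ltW.
  by rewrite lerXn2r ?nnegrE ?lipschitz_const_ge0 ?dual_norm_ge0.
case: Bc => Bc.
  rewrite (le_trans _ Bc)// ler_pdivrMl// (le_trans (ler_norm _))//.
  rewrite (le_trans (ler_norm_sum _ _ _))//.
  by rewrite (le_trans (ler_sum _ (fun (t : 'I_T) _ => h2 t)))// sumr_const card_ord mulr_natl.
by rewrite (le_trans _ Bc)// ler_wpM2l// invr_ge0.
Qed.

Lemma high_probability_bound (i : 'I_n) (T : nat) (delta : R) :
  (1 <= T)%N -> 0 < delta < 1 ->
  ((1 - delta)%:E <= mu [set w |
     (objective f (running_average x i T w) - objective f xs <=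
        base_bound n L (sigma2 P) alpha (psi xs) T
        + 8 * L * r * Num.sqrt (ln delta^-1 / T%:R))%R])%E.
Proof.
move=> T0 delta01; have T0' : 0 < T%:R :> R by rewrite ltr0n.
apply: (@high_probability i T delta (c ^+ 2)) => //; first exact: sqr_ge0.
- by move=> c0; rewrite exprn_gt0.
- by move=> t Y M h1 h2 h3; exact: weighted_drift_var h1 h2 h3.
have l0 : 0 <= ln delta^-1.
  by case/andP: delta01 => d0 d1; rewrite ln_ge0// invf_ge1// ltW.
move: (ln delta^-1) l0 => l l0.
have -> : 8 * L * r = 4 * c by rewrite /c; ring.
set u := Num.sqrt (l / T%:R); have u0 : 0 <= u by exact: sqrtr_ge0.
have u2 : u ^+ 2 = l / T%:R by rewrite sqr_sqrtr// divr_ge0// ltW.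
(* For [u >= 1] the trivial bound suffices; for [u < 1] the term [c * u ^+ 2] is at most [c * u],
   and [2 + 3 / 2 <= 4]. *)
have [u1|u1] := leP 1 u.
  by left; have := ler_wpM2l c_ge0 u1; have := mulr_ge0 c_ge0 u0; lra.
right; have -> : Num.sqrt (T%:R * c ^+ 2 * l) = T%:R * c * u.
  have Tcu : 0 <= T%:R * c * u by apply: mulr_ge0 => //; exact: mulr_ge0.
  by rewrite -[RHS](ger0_norm Tcu) -sqrtr_sqr; congr Num.sqrt; rewrite !exprMn u2; field; rewrite gt_eqF.
have -> : l = T%:R * u ^+ 2 by rewrite u2; field; rewrite gt_eqF.
have -> : T%:R^-1 * (2 * (T%:R * c * u) + 3 / 2 * c * (T%:R * u ^+ 2)) =
    2 * (c * u) + 3 / 2 * (c * u ^+ 2) by field; rewrite gt_eqF.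
have : c * u ^+ 2 <= c * u by rewrite ler_wpM2l// expr2 ler_piMl// ltW.
have := mulr_ge0 c_ge0 u0; lra.
Qed.

Lemma high_probability_bound_uncorrelated (i : 'I_n) (T : nat) (delta : R) :
  uncorrelated mu F ghat g -> (1 <= T)%N -> 0 < delta < 1 ->
  ((1 - delta)%:E <= mu [set w |
     (objective f (running_average x i T w) - objective f xs <=
        base_bound n L (sigma2 P) alpha (psi xs) T
        + 3 * L * r * ln delta^-1 / T%:R
        + 4 * L * r * Num.sqrt (ln delta^-1 / (n%:R * T%:R)))%R])%E.
Proof.
move=> unc T0 delta01; have T0' : 0 < T%:R :> R by rewrite ltr0n.
under eq_set do rewrite -addrA.
apply: (@high_probability i T delta (c ^+ 2 / n%:R)) => //.
- by rewrite divr_ge0 ?sqr_ge0// ltW.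
- by move=> c0; rewrite divr_gt0// exprn_gt0.
- by move=> t Y M h1 h2 h3; exact: weighted_drift_var_uncorrelated h1 h2 h3 unc.
have l0 : 0 <= ln delta^-1.
  by case/andP: delta01 => d0 d1; rewrite ln_ge0// invf_ge1// ltW.
move: (ln delta^-1) l0 => l l0.
right; set u := Num.sqrt (l / _); have u0 : 0 <= u by exact: sqrtr_ge0.
have nT0 : 0 < n%:R * T%:R :> R by exact: mulr_gt0.
have u2 : u ^+ 2 = l / (n%:R * T%:R) by rewrite sqr_sqrtr// divr_ge0// ltW.
have -> : Num.sqrt (T%:R * (c ^+ 2 / n%:R) * l) = T%:R * c * u.
  have Tcu : 0 <= T%:R * c * u by apply: mulr_ge0 => //; exact: mulr_ge0.
  by rewrite -[RHS](ger0_norm Tcu) -sqrtr_sqr; congr Num.sqrt; rewrite !exprMn u2; field; rewrite !gt_eqF.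
(* Here the constants agree exactly: [2 * c] is [4 * L * r] and [3 / 2 * c] is [3 * L * r]. *)
rewrite le_eqVlt; apply/orP; left; apply/eqP.
by rewrite /c; field; rewrite gt_eqF.
Qed.

End high_probability_bound.

End stochastic_dual_averaging.

Theorem theorem4 (R : realType) (n d : nat) (hn : (2 <= n)%N)
  (E : rel 'I_n) (E_sym : symmetric E)
  (f : 'I_n -> 'rV[R]_d -> R)
  (f_convex : forall i, convex_function setT (f i))
  (X : set 'rV[R]_d)
  (X_closed : closed X) (X_convex : convex_set X) (X0 : X 0)
  (nrm : 'rV[R]_d -> R) (nrm_norm : is_norm nrm)
  (L : R)
  (f_lipschitz : forall i x y, X x -> X y -> `|f i x - f i y| <= L * nrm (x - y))
  (f_subgradient : forall i x g,
     X x -> subdifferential (f i) x g -> dual_norm nrm g <= L)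
  (psi : 'rV[R]_d -> R)
  (psi_diff : forall x, differentiable psi x)
  (psi_strong : strongly_convex1 nrm X psi)
  (psi_ge0 : forall x, X x -> 0 <= psi x) (psi0 : psi 0 = 0)
  (P : 'M[R]_n)
  (P_stoch : doubly_stochastic P)
  (P_graph : forall i j, i != j -> 0 < P i j -> E i j)
  (P_gap : sigma2 P < 1)
  (alpha : nat -> R)
  (alpha_gt0 : forall t, 0 < alpha t) (alpha_noninc : nonincreasing_seq alpha)
  (dO : measure_display) (Omega : measurableType dO) (mu : probability Omega R)
  (F : nat -> set (set Omega)) (F_filtration : filtration F)
  (ghat g z x : 'I_n -> nat -> Omega -> 'rV[R]_d)
  (x_gen : dual_averaging X psi P alpha ghat z x)
  (x_adapted : adapted F ghat x)
  (g_cond_exp : forall i t, (1 <= t)%N ->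
     is_vec_cond_exp mu (F t.-1) (ghat i t) (g i t))
  (g_subgradient : forall i t, (1 <= t)%N ->
     {ae mu, forall w, subdifferential (f i) (x i t w) (g i t w)})
  (ghat_moment : forall i t, (1 <= t)%N ->
     cond_exp_le mu (F t.-1) (fun w => dual_norm nrm (ghat i t w) ^+ 2) (L ^+ 2))
  (xs : 'rV[R]_d) (xs_X : X xs) :
  [/\ (* (1) *)
      forall (i : 'I_n) (T : nat), (1 <= T)%N ->
        ('E_mu[fun w => objective f (running_average x i T w)]
           - (objective f xs)%:E
         <= (base_bound n L (sigma2 P) alpha (psi xs) T)%:E)%E,
      (* (2) *)
      has_ubound [set nrm (y - xs) | y in X] ->
      (forall i t, (1 <= t)%N ->
         {ae mu, forall w, dual_norm nrm (ghat i t w) <= L}) ->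
      forall (i : 'I_n) (T : nat) (delta : R), (1 <= T)%N -> 0 < delta < 1 ->
        ((1 - delta)%:E <=
         mu [set w | (objective f (running_average x i T w) - objective f xs
                <= base_bound n L (sigma2 P) alpha (psi xs) T
                   + 8 * L * radius_about nrm X xs
                     * Num.sqrt (ln delta^-1 / T%:R))%R])%E
    & (* (3) *)
      has_ubound [set nrm (y - xs) | y in X] ->
      (forall i t, (1 <= t)%N ->
         {ae mu, forall w, dual_norm nrm (ghat i t w) <= L}) ->
      uncorrelated mu F ghat g ->
      forall (i : 'I_n) (T : nat) (delta : R), (1 <= T)%N -> 0 < delta < 1 ->
        ((1 - delta)%:E <=
         mu [set w | (objective f (running_average x i T w) - objective f xs
                <= base_bound n L (sigma2 P) alpha (psi xs) T
                   + 3 * L * radius_about nrm X xs * ln delta^-1 / T%:R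
                   + 4 * L * radius_about nrm X xs
                     * Num.sqrt (ln delta^-1 / (n%:R * T%:R)))%R])%E].
Proof.
split.
- move=> i T T1; exact: (expectation_bound hn f_convex X_convex X0 nrm_norm
    f_lipschitz f_subgradient psi_strong psi_ge0 psi0 P_stoch P_gap alpha_gt0
    alpha_noninc F_filtration x_gen x_adapted g_cond_exp g_subgradient
    ghat_moment xs_X).
- move=> X_bounded ghat_bound i T delta T1 delta01.
  exact: (high_probability_bound hn f_convex X_convex X0 nrm_norm
    f_lipschitz f_subgradient psi_strong psi_ge0 P_stoch P_gap alpha_gt0
    alpha_noninc F_filtration x_gen x_adapted g_cond_exp g_subgradient
    xs_X X_bounded ghat_bound).
- move=> X_bounded ghat_bound unc i T delta T1 delta01.
  exact: (high_probability_bound_uncorrelated hn f_convex X_convex X0 nrm_norm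
    f_lipschitz f_subgradient psi_strong psi_ge0 P_stoch P_gap alpha_gt0
    alpha_noninc F_filtration x_gen x_adapted g_cond_exp g_subgradient
    xs_X X_bounded ghat_bound i unc T1 delta01).
Qed.
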